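(* Let $G$ be a Lie group with Lie algebra $\mathfrak g$, let $\{e_1,\dots,e_n\}$ be a basis of left invariant vector fields on $G$, and let $g$ be a left invariant pseudo-Riemannian metric (of arbitrary signature) on $G$, represented in this basis by the constant symmetric matrix $S=(s_{ij})$, $s_{ij}=g(e_i,e_j)$. Let $\omega=(\omega^i_j)$ be the matrix of Levi-Civita connection 1-forms of $g$ in this basis. Then a left invariant pseudo-Riemannian metric $\bar g$ on $G$ is geodesically equivalent to $g$ if and only if its matrix $\bar S=(\bar g(e_i,e_j))$ in the basis $\{e_1,\dots,e_n\}$ belongs to the subspace $$\mathrm{aff}(S):=\{\bar S \mid \bar S\omega+\omega^{T}\bar S=0\}.$$
   Context: All manifolds are assumed connected and of dimension $n\ge 2$. Metrics are Riemannian or pseudo-Riemannian of arbitrary signature. A metric $\bar g$ on a manifold is geodesically equivalent to a metric $g$ if every geodesic of $g$ is a reparameterized geodesic of $\bar g$. The connection 1-forms $\omega^j_i$ of the Levi-Civita connection $\nabla$ of $g$ are defined by $\nabla e_i=\sum_j \omega^j_i\, e_j$, i.e. $\nabla_X e_i=\sum_j\omega^j_i(X)e_j$; they are left invariant 1-forms. In the matrix $\omega=(\omega^i_j)$ the upper index is the row and the lower index is the column. In the definition of $\mathrm{aff}(S)$, $\bar S$ ranges over real symmetric $n\times n$ matrices, and the equation $\bar S\omega+\omega^{T}\bar S=0$ is an equation between matrices of 1-forms, i.e. $\bar S\,\omega(X)+\omega(X)^{T}\bar S=0$ for all $X\in\mathfrak g$. *)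

(* Defs.v *)
From HB Require Import structures.
From mathcomp Require Import all_boot all_order all_algebra.
From mathcomp Require Import all_classical all_reals all_analysis.
From mathcomp Require Import lra.
Set Implicit Arguments.
Unset Strict Implicit.
Unset Printing Implicit Defensive.
Import Order.TTheory GRing.Theory Num.Theory.
Import numFieldNormedType.Exports.
Local Open Scope classical_set_scope.
Local Open Scope ring_scope.

(* C^oo on an open set U: every iterated directional derivative of f is
   Frechet differentiable at every point of U (the empty list of directions
   gives f itself).  Only meant for open U, where it depends only on f|U. *)
Definition smooth_on (R : realType) (V W : normedModType R)
    (U : set V) (f : V -> W) : Prop :=
  forall (s : seq V) (x : V), U x ->
    differentiable (foldr (fun v h => 'D_v h) f s) x.

(* cmap and cinv are total; their values off cdom, resp. off the image of
   cdom, are irrelevant. *)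
Record chart (R : realType) (n : nat) (M : topologicalType) := Chart {
  cdom : set M ;
  cmap : M -> 'rV[R]_n ;
  cinv : 'rV[R]_n -> M ;
  cdom_open : open cdom ;
  cimg_open : open (cmap @` cdom) ;
  cmapK : forall p, cdom p -> cinv (cmap p) = p ;
  cmap_continuous : forall p, cdom p -> {for p, continuous cmap} ;
  cinv_continuous : forall x, (cmap @` cdom) x -> {for x, continuous cinv} }.

(* Structure of a connected smooth n-manifold on M.  A preferred chart
   [chart_at p] around each point p serves to identify the tangent space T_pM
   with 'rV[R]_n: a tangent vector at p is represented by its components in
   [chart_at p].  Hence a vector field has type M -> 'rV[R]_n and a field of
   bilinear forms has type M -> 'M[R]_n; smoothness of such fields is always
   tested on their components in the charts of the atlas. *)
Record manifold (R : realType) (n : nat) (M : topologicalType) := Manifold {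
  atlas : set (chart R n M) ;
  chart_at : M -> chart R n M ;
  chart_at_atlas : forall p, atlas (chart_at p) ;
  chart_at_dom : forall p, cdom (chart_at p) p ;
  atlas_compatible : forall phi psi, atlas phi -> atlas psi ->
    smooth_on (cmap phi @` (cdom phi `&` cdom psi)) (cmap psi \o cinv phi) ;
  manifold_hausdorff : hausdorff_space M ;
  manifold_second_countable : @second_countable M ;
  manifold_connected : connected [set: M] }.

Section Manifolds.
Variables (R : realType) (n : nat) (M : topologicalType) (D : manifold R n M).

(* Differential at p of f : M -> M, read in phi around p and psi around f p. *)
Definition chart_diff (phi psi : chart R n M) (f : M -> M) (p : M)
    (v : 'rV[R]_n) : 'rV[R]_n :=
  'D_v (cmap psi \o f \o cinv phi) (cmap phi p).

Definition tangent_map (f : M -> M) (p : M) (v : 'rV[R]_n) : 'rV[R]_n :=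
  chart_diff (chart_at D p) (chart_at D (f p)) f p v.

Definition vf_in_chart (X : M -> 'rV[R]_n) (phi : chart R n M)
    (x : 'rV[R]_n) : 'rV[R]_n :=
  let p := cinv phi x in chart_diff (chart_at D p) phi id p (X p).

Definition smooth_vf (X : M -> 'rV[R]_n) : Prop :=
  forall phi, atlas D phi -> smooth_on (cmap phi @` cdom phi) (vf_in_chart X phi).

Definition pairing (A : 'M[R]_n) (u v : 'rV[R]_n) : R := (u *m A *m v^T) 0 0.

(* The i-th coordinate vector field of phi, as an element of T_pM. *)
Definition coord_vector (phi : chart R n M) (p : M) (i : 'I_n) : 'rV[R]_n :=
  chart_diff phi (chart_at D p) id p (delta_mx 0 i).

Definition metric_in_chart (g : M -> 'M[R]_n) (phi : chart R n M)
    (x : 'rV[R]_n) : 'M[R]_n :=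
  let p := cinv phi x in
  \matrix_(i, j) pairing (g p) (coord_vector phi p i) (coord_vector phi p j).

Definition pseudo_riemannian (g : M -> 'M[R]_n) : Prop :=
  [/\ forall p, (g p)^T = g p,
      forall p, g p \in unitmx &
      forall phi, atlas D phi ->
        smooth_on (cmap phi @` cdom phi) (metric_in_chart g phi)].

(* [christoffel g phi x k i j] is the symbol Gamma^k_{ij} of the Levi-Civita
   connection of g in the chart phi. *)
Definition christoffel (g : M -> 'M[R]_n) (phi : chart R n M)
    (x : 'rV[R]_n) (k i j : 'I_n) : R :=
  let gx := metric_in_chart g phi in
  let d (a b c : 'I_n) : R := 'D_(delta_mx 0 a) (fun y => gx y b c) x in
  2^-1 * \sum_l (invmx (gx x)) k l * (d i j l + d j i l - d l i j).

Definition christoffel_form (g : M -> 'M[R]_n) (phi : chart R n M)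
    (x u v : 'rV[R]_n) : 'rV[R]_n :=
  \row_k \sum_i \sum_j christoffel g phi x k i j * u 0 i * v 0 j.

(* The vector nabla_v Y in T_pM, for v in T_pM.  It is computed in
   [chart_at D p], whose components are those that represent T_pM. *)
Definition covariant_derivative (g : M -> 'M[R]_n) (Y : M -> 'rV[R]_n)
    (p : M) (v : 'rV[R]_n) : 'rV[R]_n :=
  let phi := chart_at D p in
  'D_v (vf_in_chart Y phi) (cmap phi p)
  + christoffel_form g phi (cmap phi p) v (Y p).

Definition smooth_curve (I : set R) (gamma : R -> M) : Prop :=
  (forall t, I t -> {for t, continuous gamma}) /\
  (forall phi, atlas D phi ->
     smooth_on (I `&` gamma @^-1` cdom phi) (cmap phi \o gamma)).

(* Affinely parametrized geodesics.  Curves are total functions, considered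
   only on the open interval I. *)
Definition geodesic (g : M -> 'M[R]_n) (I : set R) (gamma : R -> M) : Prop :=
  [/\ open I, is_interval I, smooth_curve I gamma &
      forall phi t, atlas D phi -> I t -> cdom phi (gamma t) ->
        let x := cmap phi \o gamma in
        let x' := (x^`())%classic in let x'' := (x^`(2))%classic in
        x'' t + christoffel_form g phi (x t) (x' t) (x' t) = 0].

(* gbar is geodesically equivalent to g: each geodesic of g is of the form
   c \o tau with c a geodesic of gbar and tau a diffeomorphism of intervals. *)
Definition geodesically_equivalent (gbar g : M -> 'M[R]_n) : Prop :=
  forall (I : set R) (gamma : R -> M), geodesic g I gamma ->
  exists (tau : R -> R) (c : R -> M),
    [/\ smooth_on I tau,
        forall t, I t -> (tau^`())%classic t != 0,
        geodesic gbar (tau @` I) c &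
        forall t, I t -> gamma t = c (tau t)].

Definition gram (g : M -> 'M[R]_n) (e : 'I_n -> M -> 'rV[R]_n) (p : M) :
    'M[R]_n :=
  \matrix_(i, j) pairing (g p) (e i p) (e j p).

(* [omega p v] is the matrix (omega^i_j(v)) for v in T_pM, with the upper
   index i as row and the lower index j as column. *)
Definition connection_forms (g : M -> 'M[R]_n) (e : 'I_n -> M -> 'rV[R]_n)
    (omega : M -> 'rV[R]_n -> 'M[R]_n) : Prop :=
  forall p v i,
    covariant_derivative g (e i) p v = \sum_j omega p v j i *: e j p.

Lemma metric_in_chart_sym g phi x i j : pseudo_riemannian g ->
  metric_in_chart g phi x i j = metric_in_chart g phi x j i.
Proof.
move=> [gT _ _]; rewrite !mxE /pairing.
set u := coord_vector _ _ i; set v := coord_vector _ _ j.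
have -> : v *m g (cinv phi x) *m u^T = (u *m g (cinv phi x) *m v^T)^T.
  by rewrite !trmx_mul trmxK gT mulmxA.
by rewrite [RHS]mxE.
Qed.

Lemma christoffel_torsion_free g phi x k i j : pseudo_riemannian g ->
  christoffel g phi x k i j = christoffel g phi x k j i.
Proof.
move=> hg; rewrite /christoffel; congr (_ * _); apply: eq_bigr => l _.
congr (_ * _); rewrite (addrC ('D_(delta_mx 0 i) _ x)); congr (_ - _).
by congr ('D_(delta_mx 0 l) _ x); apply/funext => y; exact: metric_in_chart_sym.
Qed.

Lemma christoffel_metric g phi x a b c : pseudo_riemannian g ->
  metric_in_chart g phi x \in unitmx ->
  'D_(delta_mx 0 a) (fun y => metric_in_chart g phi y b c) x =
  \sum_k christoffel g phi x k a b * metric_in_chart g phi x k c +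
  \sum_k christoffel g phi x k a c * metric_in_chart g phi x b k.
Proof.
move=> hg ux; pose G0 := metric_in_chart g phi x.
pose d (i j k : 'I_n) : R :=
  'D_(delta_mx 0 i) (fun y => metric_in_chart g phi y j k) x.
have dS i j k : d i j k = d i k j.
  by congr ('D_(delta_mx 0 i) _ x); apply/funext => y; exact: metric_in_chart_sym.
have low i j m : \sum_k christoffel g phi x k i j * G0 m k =
    2^-1 * (d i j m + d j i m - d m i j).
  under eq_bigr => k _ do
    rewrite /christoffel -mulrA mulr_suml.
  rewrite -mulr_sumr exchange_big /=; congr (_ * _).
  transitivity (\sum_l (G0 *m invmx G0) m l * (d i j l + d j i l - d l i j)).
    apply: eq_bigr => l _; rewrite mxE mulr_suml; apply: eq_bigr => k _.
    by rewrite mulrAC [X in X * _]mulrC.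
  rewrite mulmxV // (bigD1 m) //= mxE eqxx mul1r big1 ?addr0// => l lm.
  by rewrite mxE eq_sym (negbTE lm) mul0r.
have -> : \sum_k christoffel g phi x k a b * metric_in_chart g phi x k c =
          \sum_k christoffel g phi x k a b * G0 c k.
  by apply: eq_bigr => k _; rewrite (metric_in_chart_sym _ _ _ _ hg).
rewrite !low (dS a c b) -/(d a b c).
by move: (d a b c) (d b a c) (d c a b) => u v w; lra.
Qed.

End Manifolds.

HB.mixin Record isTopologicalGroup G of Topological G & Group G := {
  mulg_continuous : continuous (fun xy : G * G => (xy.1 * xy.2)%g) ;
  invg_continuous : continuous (fun x : G => (x^-1)%g) }.

#[short(type="topologicalGroupType")]
HB.structure Definition TopologicalGroup :=
  {G of Topological G & Group G & isTopologicalGroup G}.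

Record lieGroup (R : realType) (n : nat) := LieGroup {
  lie_sort :> topologicalGroupType ;
  lie_manifold :> manifold R n lie_sort ;
  lie_mul_smooth : forall phi psi chi,
    atlas lie_manifold phi -> atlas lie_manifold psi ->
    atlas lie_manifold chi ->
    smooth_on
      [set xy : 'rV[R]_n * 'rV[R]_n |
        [/\ (cmap phi @` cdom phi) xy.1, (cmap psi @` cdom psi) xy.2 &
            cdom chi (cinv phi xy.1 * cinv psi xy.2)%g]]
      (fun xy => cmap chi (cinv phi xy.1 * cinv psi xy.2)%g) ;
  lie_inv_smooth : forall phi psi,
    atlas lie_manifold phi -> atlas lie_manifold psi ->
    smooth_on
      [set x | (cmap phi @` cdom phi) x /\ cdom psi ((cinv phi x)^-1)%g]
      (fun x => cmap psi ((cinv phi x)^-1)%g) }.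

Section LieGroups.
Variables (R : realType) (n : nat) (G : lieGroup R n).

Definition left_translation_diff (a p : G) (v : 'rV[R]_n) : 'rV[R]_n :=
  tangent_map G (fun q : G => (a * q)%g) p v.

(* The Lie algebra of G is the real vector space of these fields. *)
Definition left_invariant_vf (X : G -> 'rV[R]_n) : Prop :=
  smooth_vf G X /\
  forall a p : G, X (a * p)%g = left_translation_diff a p (X p).

Definition lie_algebra_basis (e : 'I_n -> G -> 'rV[R]_n) : Prop :=
  (forall i, left_invariant_vf (e i)) /\
  (forall X, left_invariant_vf X ->
     exists! c : 'rV[R]_n, forall p, X p = \sum_i c 0 i *: e i p).

Definition left_invariant_metric (g : G -> 'M[R]_n) : Prop :=
  pseudo_riemannian G g /\
  forall (a p : G) (u v : 'rV[R]_n),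
    pairing (g (a * p)%g)
      (left_translation_diff a p u) (left_translation_diff a p v) =
    pairing (g p) u v.

(* aff(S), where omega is the matrix of connection 1-forms of the metric with
   matrix S; the defining equation is evaluated on the Lie algebra. *)
Definition aff (omega : G -> 'rV[R]_n -> 'M[R]_n) : set 'M[R]_n :=
  [set T | T^T = T /\
    forall X, left_invariant_vf X -> forall p : G,
      T *m omega p (X p) + (omega p (X p))^T *m T = 0].

Lemma aff0 omega : aff omega 0.
Proof. by split=> [|X _ p]; rewrite ?trmx0 // mul0mx mulmx0 addr0. Qed.

Lemma aff_linear omega (a : R) (T1 T2 : 'M[R]_n) :
  aff omega T1 -> aff omega T2 -> aff omega (a *: T1 + T2).
Proof.
move=> [s1 h1] [s2 h2]; split=> [|X hX p].
  by rewrite linearP /= s1 s2.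
rewrite mulmxDl mulmxDr -scalemxAl -scalemxAr addrACA -scalerDr.
by rewrite h1 // h2 // scaler0 addr0.
Qed.

End LieGroups.

(* Main.v *)
Require Import Defs.
From HB Require Import structures.
From mathcomp Require Import all_boot all_order all_algebra.
From mathcomp Require Import all_classical all_reals all_analysis.
From mathcomp Require Import ring lra.
Set Implicit Arguments.
Unset Strict Implicit.
Unset Printing Implicit Defensive.
Import Order.TTheory GRing.Theory Num.Theory.
Import numFieldNormedType.Exports.
Local Open Scope classical_set_scope.
Local Open Scope ring_scope.

(** The metrics g and gbar are geodesically equivalent exactly when their
    Levi-Civita connections coincide, and aff says, in the left invariant
    frame, that gbar is parallel for the connection of g.

    If gbar is parallel, the torsion-free connection of g is also a metric
    connection of gbar, hence equals the Levi-Civita connection of gbar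
    ([christoffel_unique]); the two metrics then have the same geodesics, with
    the same parametrization ([aff_equivalent]).

    Conversely, let P be the difference of the Christoffel symbols of gbar and
    g. Comparing the two geodesic equations along one curve with velocity v
    gives P(v, v) = l v for some scalar l
    ([geodesically_equivalent_christoffel]); as there is a geodesic of g with
    any given initial velocity ([geodesic_exists]), this holds for every v. Such
    a tensor is determined by its trace, and vanishes with it
    ([weyl_trace_free]). The trace does vanish: in a frame E in which the metric
    has a constant Gram matrix, the trace of the connection is
    - tr (E^-1 dE), an expression that does not involve the metric
    ([christoffel_trace]). This replaces the usual remark that the ratio of the
    volume forms of two left invariant metrics is constant.

    The bridge to aff is obtained by differentiating the identity
    E H E^T = Sbar, where H is the matrix of gbar in a chart
    ([aff_covariant_derivative]). The group structure enters through left
    translations: they make a basis of the Lie algebra a frame at every point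
    ([lie_algebra_basis_unit]).

    The analytic ground is the existence of smooth geodesics. Local solutions
    of the geodesic equation come from Picard iteration ([picard_lindelof],
    [ode_local]) and are smooth by bootstrapping ([ode_smooth]). A geodesic
    must satisfy the equation in every chart; invariance under a change of
    chart is proved on the Euler-Lagrange form of the equation, where the
    second derivatives of the transition map cancel because they are symmetric
    ([derive_symmetric], [euler_lagrange_transition]). *)

(** * Finite orders of smoothness *)

Lemma near_eq_differentiable (R : numFieldType) (V W : normedModType R)
    (f g : V -> W) (x : V) :
  (\near x, f x = g x) -> differentiable f x -> differentiable g x.
Proof.
move=> fg df.
have dg : g \o shift x = cst (g x) + 'd f x +o_ 0 id.
  apply/eqaddoP => e e0.
  have [_ /eqaddoP/(_ e e0)] := (diff_locallyP x f).1 df.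
  have fg0 : \forall y \near (0 : V), f (y + x) = g (y + x).
    by move: fg; rewrite (near_shift 0 x); apply: filterS => y; rewrite /= subr0.
  apply: filterS2 fg0 => y fgy; rewrite !fctE /= -fgy.
  by rewrite (nbhs_singleton fg).
apply/diff_locallyP.
have -> : 'd g x = 'd f x :> (V -> W).
  by apply: diff_unique => //; exact: diff_continuous.
by split => //; exact: diff_continuous.
Qed.

Section Ck.
Variable R : realType.

(** Differentiability persisting through k directional derivations, so that
    [smooth_on] is [Ck] for all k. The derivation applied first is peeled off
    first: the derivative of a product or of a composite is a sum of products
    of functions of lower order, and closure follows by induction on k. *)
Fixpoint Ck (V W : normedModType R) (U : set V) (k : nat) (f : V -> W) : Prop :=
  (forall x, U x -> differentiable f x) /\
  (if k is k'.+1 then forall v, Ck U k' ('D_v f) else True).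

Section general.
Variables (V : normedModType R) (U : set V).

Lemma Ck_differentiable (W : normedModType R) k (f : V -> W) x :
  Ck U k f -> U x -> differentiable f x.
Proof. by case: k => [|k] [h _]; exact: h. Qed.

Lemma CkW (W : normedModType R) k (f : V -> W) : Ck U k.+1 f -> Ck U k f.
Proof.
by elim: k f => [|k IH] f [df h]; split => // v; exact/IH/h.
Qed.

Lemma smooth_onP (W : normedModType R) (f : V -> W) :
  smooth_on U f <-> forall k, Ck U k f.
Proof.
split=> [sf k | h s x Ux].
  elim: k f sf => [|k IH] f sf; first by split => // x; exact: (sf [::]).
  split=> [x|v]; first exact: (sf [::]).
  by apply: IH => s x Ux; have := sf (rcons s v) x Ux; rewrite foldr_rcons.
elim/last_ind: s f h => [|s v IH] f h.
  exact: Ck_differentiable (h 0%N) Ux.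
by rewrite foldr_rcons; apply: IH => k; exact: (h k.+1).2.
Qed.

Lemma smooth_on_derive (W : normedModType R) (f : V -> W) v :
  smooth_on U f -> smooth_on U ('D_v f).
Proof. by move=> sf s x Ux; have := sf (rcons s v) x Ux; rewrite foldr_rcons. Qed.

Lemma smooth_on_differentiable (W : normedModType R) (f : V -> W) x :
  smooth_on U f -> U x -> differentiable f x.
Proof. by move=> sf; exact: (sf [::]). Qed.

Hypothesis oU : open U.

Lemma near_open x : U x -> \forall y \near x, U y.
Proof. by move=> Ux; exact: open_nbhs_nbhs. Qed.

Lemma Ck_eq (W : normedModType R) k (f g : V -> W) :
  {in U, f =1 g} -> Ck U k f -> Ck U k g.
Proof.
have nr (f' g' : V -> W) x : {in U, f' =1 g'} -> U x -> \near x, f' x = g' x.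
  by move=> fg /near_open; apply: filterS => y Uy; apply/fg/mem_set.
have dfg (f' g' : V -> W) x : {in U, f' =1 g'} -> (forall x, U x -> differentiable f' x) ->
     U x -> differentiable g' x.
  by move=> fg df Ux; apply: near_eq_differentiable (df x Ux); exact: nr.
elim: k f g => [|k IH] f g fg [df h].
  by split => // x; exact: dfg fg df.
split=> [x|v]; first exact: dfg fg df.
apply: IH (h v) => x /set_mem Ux; apply: near_eq_derive; exact: nr.
Qed.

Lemma Ck_cst (W : normedModType R) k (a : W) : Ck U k (cst a).
Proof.
elim: k a => [|k IH] a; split => // v.
by apply: Ck_eq (IH 0) => x _; rewrite derive_cst.
Qed.

Lemma Ck_linear (W W' : normedModType R) (l : {linear W -> W'}) k (f : V -> W) :
  continuous l -> Ck U k f -> Ck U k (l \o f).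
Proof.
move=> cl; elim: k f => [|k IH] f [df h].
  split => // x Ux.
  by apply: differentiable_comp; [exact: df|exact: linear_differentiable].
split=> [x Ux|v].
  by apply: differentiable_comp; [exact: df|exact: linear_differentiable].
apply: Ck_eq (IH _ (h v)) => x /set_mem Ux.
have dl : differentiable l (f x) by exact: linear_differentiable.
rewrite [RHS](deriveE v (differentiable_comp (df x Ux) dl)).
rewrite (diff_comp (df x Ux) dl) /= (deriveE v (df x Ux)).
by rewrite diff_lin.
Qed.

Lemma CkD (W : normedModType R) k (f g : V -> W) :
  Ck U k f -> Ck U k g -> Ck U k (f + g).
Proof.
elim: k f g => [|k IH] f g [df hf] [dg hg].
  by split => // x Ux; apply: differentiableD; auto.
split=> [x Ux|v]; first by apply: differentiableD; auto.
apply: Ck_eq (IH _ _ (hf v) (hg v)) => x /set_mem Ux /=.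
by rewrite deriveD //; apply: diff_derivable; auto.
Qed.

Lemma Ck_sum (W : normedModType R) k (I : Type) (r : seq I) (P : pred I)
    (f : I -> V -> W) :
  (forall i, P i -> Ck U k (f i)) -> Ck U k (fun x => \sum_(i <- r | P i) f i x).
Proof.
move=> h; elim: r => [|i r IH].
  by apply: Ck_eq (Ck_cst k 0) => x _; rewrite big_nil.
have [Pi|Pi] := boolP (P i).
  by apply: Ck_eq (CkD (h i Pi) IH) => x _; rewrite big_cons Pi.
by apply: Ck_eq IH => x _; rewrite big_cons (negbTE Pi).
Qed.

Lemma CkM k (f g : V -> R) :
  Ck U k f -> Ck U k g -> Ck U k (fun x => f x * g x).
Proof.
elim: k f g => [|k IH] f g hf hg.
  split => // x Ux.
  exact: (differentiableM (Ck_differentiable hf Ux) (Ck_differentiable hg Ux)).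
split=> [x Ux|v].
  exact: (differentiableM (Ck_differentiable hf Ux) (Ck_differentiable hg Ux)).
have h1 := IH _ _ (CkW hf) (hg.2 v); have h2 := IH _ _ (CkW hg) (hf.2 v).
apply: Ck_eq (CkD h1 h2) => x /set_mem Ux /=.
rewrite (@deriveM _ _ f g) //; apply: diff_derivable.
  exact: (Ck_differentiable hf Ux).
exact: (Ck_differentiable hg Ux).
Qed.

Lemma Ck_prod k (I : Type) (r : seq I) (P : pred I) (f : I -> V -> R) :
  (forall i, P i -> Ck U k (f i)) -> Ck U k (fun x => \prod_(i <- r | P i) f i x).
Proof.
move=> h; elim: r => [|i r IH].
  apply: (Ck_eq (f := fun=> 1 : R)) => [x _|]; first by rewrite big_nil.
  exact: Ck_cst.
have [Pi|Pi] := boolP (P i).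
  by apply: Ck_eq (CkM (h i Pi) IH) => x _; rewrite big_cons Pi.
by apply: Ck_eq IH => x _; rewrite big_cons (negbTE Pi).
Qed.

(** The derivative - f^-2 f' involves f^-1 only at a lower order. *)
Lemma CkV k (f : V -> R) : (forall x, U x -> f x != 0) ->
  Ck U k f -> Ck U k (fun x => (f x)^-1).
Proof.
move=> f0; elim: k => [|k IH] hf.
  split => // x Ux.
  by apply: differentiableV; [exact: (Ck_differentiable hf Ux)|exact: f0].
split=> [x Ux|v].
  by apply: differentiableV; [exact: (Ck_differentiable hf Ux)|exact: f0].
have h := IH (CkW hf).
have h1 : Ck U k (fun=> -1 : R) by exact: Ck_cst.
have := CkM (CkM h1 (CkM h h)) (hf.2 v).
apply: Ck_eq => x /set_mem Ux /=.
rewrite deriveV ?f0 //; last by apply: diff_derivable; exact: (Ck_differentiable hf Ux).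
by rewrite mulN1r expr2 invfM.
Qed.

End general.
End Ck.

Lemma near_eq_on (R : realType) (V W : normedModType R) (U : set V)
    (f g : V -> W) x :
  open U -> U x -> (forall y, U y -> f y = g y) -> \near x, f x = g x.
Proof.
by move=> oU Ux fg; apply: filterS (near_open oU Ux) => y Uy; exact: fg.
Qed.

(** * Matrix-valued functions and composition *)

Section CkMatrix.
Variable R : realType.

(** Bundled as linear maps, so that they preserve [Ck] by [Ck_linear]. *)
Definition coord_lin m n (i : 'I_m) (j : 'I_n) (M : 'M[R]_(m, n)) : R := M i j.

Lemma coord_lin_is_linear m n (i : 'I_m) (j : 'I_n) : linear (coord_lin i j).
Proof. by move=> a u v; rewrite /coord_lin !mxE. Qed.

HB.instance Definition _ m n (i : 'I_m) (j : 'I_n) :=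
  GRing.isLinear.Build R 'M[R]_(m, n) R _ (coord_lin i j)
    (coord_lin_is_linear i j).

Definition scale_at (W : normedModType R) (w : W) (a : R) : W := a *: w.

Lemma scale_at_is_linear (W : normedModType R) (w : W) : linear (scale_at w).
Proof. by move=> a u v; rewrite /scale_at scalerDl scalerA. Qed.

HB.instance Definition _ (W : normedModType R) (w : W) :=
  GRing.isLinear.Build R R W _ (scale_at w) (scale_at_is_linear w).

Variables (V : normedModType R) (U : set V).
Hypothesis oU : open U.

Lemma Ck_mxP m n k (f : V -> 'M[R]_(m, n)) :
  Ck U k f <-> forall i j, Ck U k (fun x => f x i j).
Proof.
split=> [h i j|h].
  by apply: (Ck_linear oU (l := coord_lin i j)) h => M; exact: coord_continuous.
apply: (Ck_eq oU (f := fun x => \sum_i \sum_j f x i j *: delta_mx i j)) => //.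
  by move=> x _; rewrite -matrix_sum_delta.
apply: Ck_sum => // i _; apply: Ck_sum => // j _.
apply: (Ck_linear oU (l := scale_at (delta_mx i j))) (h i j).
by move=> a; exact: scalel_continuous.
Qed.

Lemma Ck_det n k (A : V -> 'M[R]_n) :
  Ck U k A -> Ck U k (fun x => \det (A x)).
Proof.
move=> /Ck_mxP hA; apply: Ck_sum => // s _.
apply: CkM => //; first exact: Ck_cst.
by apply: Ck_prod => // i _; exact: hA.
Qed.

(** By Cramer's rule: cofactors divided by the determinant. *)
Lemma Ck_invmx n k (A : V -> 'M[R]_n) : (forall x, U x -> A x \in unitmx) ->
  Ck U k A -> Ck U k (fun x => invmx (A x)).
Proof.
move=> uA hA; apply/Ck_mxP => i j.
apply: (Ck_eq oU (f := fun x => (\det (A x))^-1 * cofactor (A x) j i)).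
  by move=> x /set_mem/uA ux; rewrite /invmx ux !mxE.
apply: (CkM oU).
  apply: (CkV oU) => [x /uA|]; last exact: Ck_det.
  by rewrite unitmxE unitfE.
rewrite /cofactor; apply: (CkM oU); first exact: Ck_cst.
apply: Ck_det; apply/Ck_mxP => a b.
by apply: Ck_eq ((Ck_mxP _ _).1 hA (lift j a) (lift i b)) => // x _; rewrite !mxE.
Qed.

Lemma derive_comp_rV (W : normedModType R) m (f : V -> 'rV[R]_m)
    (h : 'rV[R]_m -> W) x v :
  differentiable f x -> differentiable h (f x) ->
  'D_v (h \o f) x = \sum_i ('D_v f x) 0 i *: 'D_(delta_mx 0 i) h (f x).
Proof.
move=> df dh; rewrite (deriveE _ (differentiable_comp df dh)).
rewrite (diff_comp df dh) /= -(deriveE _ df) {1}['D_v f x]row_sum_delta.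
by rewrite linear_sum; apply: eq_bigr => i _; rewrite linearZ (deriveE _ dh).
Qed.

End CkMatrix.

(** The chain rule in coordinates of the middle space writes a derivative of
    the composite with first derivatives of both functions, one order lower. *)
Lemma Ck_comp_scalar (R : realType) (V : normedModType R) (U : set V) m
    (U' : set 'rV[R]_m) k (f : V -> 'rV[R]_m) (h : 'rV[R]_m -> R) :
  open U -> (forall x, U x -> U' (f x)) ->
  Ck U' k h -> Ck U k f -> Ck U k (h \o f).
Proof.
move=> oU UU'; elim: k h => [|k IH] h [dh hh] [df hf].
  by split => // x Ux; apply: differentiable_comp; auto.
split=> [x Ux|v]; first by apply: differentiable_comp; auto.
apply: (Ck_eq oU
   (f := fun x => \sum_i ('D_v f x) 0 i * ('D_(delta_mx 0 i) h \o f) x)).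
  by move=> x /set_mem Ux; rewrite derive_comp_rV; auto.
apply: Ck_sum => // i _; apply: CkM => //; last first.
  by apply: (IH _ (hh _)); apply: (CkW (k := k)); split.
by have /(Ck_mxP oU) := hf v; apply.
Qed.

Lemma Ck_comp (R : realType) (V : normedModType R) (U : set V) m p q
    (U' : set 'rV[R]_m) k (f : V -> 'rV[R]_m) (h : 'rV[R]_m -> 'M[R]_(p, q)) :
  open U -> open U' -> (forall x, U x -> U' (f x)) ->
  Ck U' k h -> Ck U k f -> Ck U k (h \o f).
Proof.
move=> oU oU' UU' /(Ck_mxP oU') hh hf; apply/Ck_mxP => // i j.
exact: (Ck_comp_scalar oU UU' (hh i j)).
Qed.

(** * Symmetry of second derivatives *)

Section Schwarz.
Variables (R : realType) (V : normedModType R).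

Lemma is_derive_line (f : V -> R) (x v : V) (s : R) :
  differentiable f (x + s *: v) ->
  is_derive s (1 : R) (fun s : R => f (x + s *: v)) ('D_v f (x + s *: v)).
Proof.
move=> df.
have cv : continuous (scale_at v) by move=> a; exact: scalel_continuous.
have dv : differentiable (scale_at v) s by exact: linear_differentiable.
have dc : differentiable (cst x : R -> V) s by exact: differentiable_cst.
pose l : R -> V := cst x + scale_at v.
have dl : differentiable l s by exact: differentiableD.
have dfl : differentiable (f \o l) s by exact: differentiable_comp.
have -> : 'D_v f (x + s *: v) = 'D_1 (f \o l) s.
  rewrite (deriveE _ dfl) (diff_comp dl df) /= (deriveE _ df); congr ('d f _ _).
  by rewrite (diffD dc dv) diff_cst diff_lin // /= add0r /scale_at scale1r.
by apply: DeriveDef => //; exact: diff_derivable.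
Qed.

Lemma MVT_line (f : V -> R) (x v : V) (h : R) : 0 < h ->
  (forall s, 0 <= s <= h -> differentiable f (x + s *: v)) ->
  exists2 s, 0 <= s <= h & f (x + h *: v) - f x = 'D_v f (x + s *: v) * h.
Proof.
move=> h0 df.
pose F s := f (x + s *: v); pose dF s := 'D_v f (x + s *: v).
have dF' s : 0 <= s <= h -> is_derive s (1 : R) F (dF s).
  by move=> /df; exact: is_derive_line.
have F1 s : s \in `]0, h[ -> is_derive s (1 : R) F (dF s).
  by rewrite in_itv /= => /andP[s0 sh]; apply: dF'; rewrite !ltW.
have F2 : {within `[0, h], continuous F}.
  apply: continuous_in_subspaceT => s; rewrite inE /= in_itv /= => /dF' [ds _].
  by apply: differentiable_continuous; apply/derivable1_diffP.
have [s sI] := MVT h0 F1 F2.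
rewrite {1 2}/F scale0r addr0 subr0 => ->; exists s => //.
by move: sI; rewrite in_itv /= => /andP[s0 sh]; rewrite !ltW.
Qed.

Lemma derive_translate (f : V -> R) (w x u : V) :
  'D_u (fun y => f (y + w)) x = 'D_u f (x + w).
Proof.
pose D (g : V -> R) y (h : R) := h^-1 *: ((g \o shift y) (h *: u) - g y).
have E : D (fun y => f (y + w)) x = D f (x + w).
  by apply/funext => h; rewrite /D /= addrA.
exact: (congr1 (fun k : R -> R => lim (k @ 0^')) E).
Qed.

(** The mean value theorem is applied twice: in the direction u to the
    increment of f along v, then in the direction v to the derivative of f
    along u. *)
Lemma second_difference (U : set V) (f : V -> R) (x u v : V) (h : R) :
  Ck U 1 f -> 0 < h ->
  (forall a b, 0 <= a <= h -> 0 <= b <= h -> U (x + a *: u + b *: v)) ->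
  exists a b, [/\ 0 <= a <= h, 0 <= b <= h &
    f (x + h *: u + h *: v) - f (x + h *: u) - (f (x + h *: v) - f x) =
    'D_v ('D_u f) (x + a *: u + b *: v) * h * h].
Proof.
move=> [df ddf] h0 hU.
have hh : 0 <= h <= h by rewrite lexx ltW.
have h00 : 0 <= (0 : R) <= h by rewrite lexx ltW.
pose F : V -> R := fun y => f (y + h *: v) - f y.
have sh (w y : V) : differentiable (fun z : V => z + w) y.
  by apply: (differentiableD (f := id) (g := cst w)) => //; exact: differentiable_cst.
have Uv a : 0 <= a <= h -> U (x + a *: u + h *: v) by move=> ah; exact: hU.
have U0 a : 0 <= a <= h -> U (x + a *: u).
  by move=> ah; have := hU a 0 ah h00; rewrite scale0r addr0.
have d1 a : 0 <= a <= h -> differentiable (fun y => f (y + h *: v)) (x + a *: u).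
  by move=> ah; apply: (differentiable_comp (sh _ _)); apply: df; exact: Uv.
have dF a : 0 <= a <= h -> differentiable F (x + a *: u).
  by move=> ah; apply: differentiableB; [exact: d1|apply: df; exact: U0].
have [a ah] := MVT_line h0 dF.
have -> : 'D_u F (x + a *: u) = 'D_u f (x + a *: u + h *: v) - 'D_u f (x + a *: u).
  rewrite /F deriveB; [|apply: diff_derivable..]; [|exact: d1|by apply: df; exact: U0].
  by rewrite derive_translate.
move=> E1.
have dDu b : 0 <= b <= h -> differentiable ('D_u f) (x + a *: u + b *: v).
  by move=> bh; apply: (ddf u).1; exact: hU.
have [b bh E2] := MVT_line h0 dDu.
by exists a, b; split => //; rewrite -E2 -E1.
Qed.

Lemma continuous_eq_close (F G : V -> R) (x : V) :
  {for x, continuous F} -> {for x, continuous G} ->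
  (forall r, 0 < r -> exists y z, [/\ ball x r y, ball x r z & F y = G z]) ->
  F x = G x.
Proof.
move=> cF cG h; apply/eqP; rewrite -subr_eq0 -normr_eq0.
rewrite eq_le normr_ge0 andbT; apply/ler_addgt0Pr => e e0; rewrite add0r.
have e2 : 0 < e / 2 by rewrite divr_gt0.
have h1 : \forall y \near x, `|F x - F y| < e / 2 by exact: (cvgrPdist_lt _ _).1 cF _ e2.
have h2 : \forall y \near x, `|G x - G y| < e / 2 by exact: (cvgrPdist_lt _ _).1 cG _ e2.
have h12 : \forall y \near x, `|F x - F y| < e / 2 /\ `|G x - G y| < e / 2.
  exact: filterI h1 h2.
move/nbhs_ballP : h12 => [r /= r0 hr].
have [y [z [by_ bz E]]] := h r r0.
have [+ _] := hr y by_; have [_ +] := hr z bz; rewrite E => hz hy.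
rewrite (splitr e) ltW // -(subrKA (G z)).
by apply: le_lt_trans (ler_normD _ _) _; apply: ltrD => //; rewrite distrC.
Qed.

(** Both mixed derivatives, at suitable points near x, are the same second
    difference divided by h^2, and both are continuous at x. *)
Lemma derive_symmetric (U : set V) (f : V -> R) (x u v : V) :
  open U -> U x -> Ck U 2 f -> 'D_v ('D_u f) x = 'D_u ('D_v f) x.
Proof.
move=> oU Ux hf; have hf1 := CkW hf.
apply: (@continuous_eq_close ('D_v ('D_u f)) ('D_u ('D_v f))) => [||r0 r00].
- by apply: differentiable_continuous; exact: (((hf.2 u).2 v).1 _ Ux).
- by apply: differentiable_continuous; exact: (((hf.2 v).2 u).1 _ Ux).
have bU : \forall y \near x, U y /\ ball x r0 y.
  exact: filterI (near_open oU Ux) (nbhsx_ballx x _ r00).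
move/nbhs_ballP : bU => [r /= rp hr].
(* The parallelogram with sides h u and h v then lies in the ball of radius r. *)
pose K := `|u| + `|v| + 1.
have K0 : 0 < K by rewrite ltr_wpDl // addr_ge0.
pose h := r / K.
have h0 : 0 < h by rewrite divr_gt0.
have hball a b : 0 <= a <= h -> 0 <= b <= h -> ball x r (x + a *: u + b *: v).
  move=> /andP[a0 ah] /andP[b0 bh].
  rewrite -ball_normE /= -addrA opprD addrA subrr add0r normrN.
  apply: le_lt_trans (ler_normD _ _) _; rewrite !normrZ (ger0_norm a0) (ger0_norm b0).
  apply: (@le_lt_trans _ _ (h * (`|u| + `|v|))).
    by rewrite mulrDr lerD // ler_wpM2r.
  by rewrite /h mulrAC ltr_pdivrMr // ltr_pM2l // ltrDl.
have hU a b ah bh := hr _ (hball a b ah bh).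
have [a [b [ah bh E1]]] := second_difference hf1 h0
  (fun a b ah bh => (hU a b ah bh).1).
have [|b' [a' [bh' ah' E2]]] := @second_difference U f x v u _ hf1 h0.
  by move=> b' a' bh' ah'; rewrite addrAC; exact: (hU _ _ ah' bh').1.
exists (x + a *: u + b *: v), (x + b' *: v + a' *: u); split.
- exact: (hU _ _ ah bh).2.
- by rewrite addrAC; exact: (hU _ _ ah' bh').2.
apply: (mulIf (lt0r_neq0 h0)); apply: (mulIf (lt0r_neq0 h0)).
apply: (etrans (esym E1)); apply: (etrans _ E2).
rewrite (addrAC x (h *: v)); move: (f _) (f _) (f _) (f _) => p q s t.
by ring.
Qed.
End Schwarz.

(** * Estimates on the real line *)

Section RowNorm.
Variable R : realType.

Lemma rV_coord_le m (v : 'rV[R]_m) i : `|v 0 i| <= `|v|.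
Proof.
rewrite [leRHS]/Num.Def.normr /= mx_normrE.
exact: (le_bigmax _ (fun ij : 'I_1 * 'I_m => `|v ij.1 ij.2|) (0, i)).
Qed.

Lemma rV_norm_le m (v : 'rV[R]_m) e :
  0 <= e -> (forall i, `|v 0 i| <= e) -> `|v| <= e.
Proof.
move=> e0 h; rewrite [leLHS]/Num.Def.normr /= mx_normrE.
by rewrite (bigmax_le _ e0) //= => -[i j] _; rewrite ord1.
Qed.

Lemma rV_continuous (V : normedModType R) m (f : V -> 'rV[R]_m) x :
  (forall i, {for x, continuous (fun y => f y 0 i)}) -> {for x, continuous f}.
Proof.
move=> h; apply/cvgrPdist_le => e e0.
have H i : \forall y \near x, `|f x 0 i - f y 0 i| <= e.
  exact: (cvgrPdist_le _ _).1 (h i) _ e0.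
near=> y; apply: rV_norm_le => [|i]; first exact: ltW.
by rewrite !mxE; move: i; near: y; exact: filter_forall H.
Unshelve. all: by end_near. Qed.

(** The points s and t may come in either order: 0 is an interior point of the
    interval on which the iterations below take place. *)
Lemma MVT_sym (d s t : R) (f df : R -> R) : `|s| < d -> `|t| < d ->
  (forall u, `|u| < d -> is_derive u (1 : R) f (df u)) ->
  exists c, [/\ `|c| < d, `|c - s| <= `|t - s| & f t - f s = df c * (t - s)].
Proof.
move=> sd td hf.
have key a b : `|a| < d -> `|b| < d -> a <= b ->
    exists c, [/\ `|c| < d, a <= c <= b & f b - f a = df c * (b - a)].
  rewrite !ltr_norml => /andP[a1 a2] /andP[b1 b2] ab.
  have cI c : a <= c <= b -> `|c| < d.
    move=> /andP[c1 c2]; rewrite ltr_norml (lt_le_trans a1 c1).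
    by rewrite (le_lt_trans c2 b2).
  have [x||c cab E] := @MVT_segment R f df a b ab.
  - rewrite in_itv /= => /andP[x1 x2]; apply: hf; apply: cI.
    by rewrite !ltW.
  - apply: continuous_in_subspaceT => x; rewrite inE /= in_itv /= => /cI/hf[dx _].
    by apply: differentiable_continuous; apply/derivable1_diffP.
  - by move: cab; rewrite in_itv /= => /[dup] /cI; exists c.
have [st|ts] := leP s t.
  have [c [cd /andP[c1 c2] E]] := key s t sd td st; exists c; split => //.
  by rewrite !ger0_norm ?subr_ge0 // lerD2r.
have [c [cd /andP[c1 c2] E]] := key t s td sd (ltW ts); exists c; split => //.
  by rewrite !ler0_norm ?subr_le0 ?(ltW ts) // lerN2 lerD2r.
by rewrite -[LHS]opprB E -mulrN opprB.
Qed.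

Lemma le_of_geometric (a b K : R) : (forall k, a <= b + K / 2 ^+ k) -> a <= b.
Proof.
move=> h; apply/ler_addgt0Pr => e e0.
have [K0|K0] := leP K 0.
  apply: (le_trans (h 0%N)); rewrite expr0 divr1 lerD2l.
  by rewrite (le_trans K0) // ltW.
have [k hk] : exists k : nat, K / e <= k%:R.
  by exists (Num.truncn (K / e)).+1; rewrite ltW // truncnS_gt.
apply: (le_trans (h k)); rewrite lerD2l ler_pdivrMr ?exprn_gt0 //.
rewrite -ler_pdivrMl // mulrC (le_trans hk) // -natrX ler_nat.
by rewrite ltnW // ltn_expl.
Qed.

(** The limit is the supremum of the increasing sequence a k - 2 C / 2^k, which
    stays below the decreasing sequence a k + 2 C / 2^k. *)
Lemma geometric_limit (a : nat -> R) (C : R) :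
  (forall k, `|a k.+1 - a k| <= C / 2 ^+ k) ->
  exists l, forall k, `|a k - l| <= 2 * C / 2 ^+ k.
Proof.
move=> h.
have C0 : 0 <= C by have := le_trans (normr_ge0 _) (h 0%N); rewrite expr0 divr1.
pose w k : R := C / 2 ^+ k.
have w0 k : 0 <= w k by rewrite divr_ge0 // exprn_ge0.
have w2 k : 2 * C / 2 ^+ k = 2 * w k by rewrite /w mulrA.
have wS k : w k = 2 * w k.+1.
  by rewrite /w exprS invfM [RHS]mulrCA mulVKf // pnatr_eq0.
pose b k := a k - 2 * w k; pose c k := a k + 2 * w k.
have bS k : b k <= b k.+1.
  have := h k; rewrite -/(w k) ler_norml /b => /andP[h1 _].
  by have := wS k; lra.
have cS k : c k.+1 <= c k.
  have := h k; rewrite -/(w k) ler_norml /c => /andP[_ h1].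
  by have := wS k; lra.
have bm : {homo b : i j / (i <= j)%N >-> i <= j} by apply: homo_leq (@le_trans _ _) bS.
have cm : {homo c : i j / (i <= j)%N >-> j <= i}.
  apply: (@homo_leq _ _ (fun x y => y <= x)) cS => // x y z h1 h2.
  exact: le_trans h2 h1.
have bc i j : b i <= c j.
  pose k := maxn i j.
  apply: (le_trans (bm i k (leq_maxl _ _))); apply: (le_trans _ (cm j k (leq_maxr _ _))).
  by rewrite /b /c; have := w0 k; lra.
have hs : has_sup (range b).
  by split; [exists (b 0%N), 0%N | exists (c 0%N) => _ [i _ <-]].
exists (sup (range b)) => k; rewrite w2 ler_norml.
have h1 : b k <= sup (range b) by apply: ub_le_sup; [exact: hs.2|exists k].
have h2 : sup (range b) <= c k.
  by apply: ge_sup; [exact: hs.1|move=> _ [i _ <-]].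
by move: h1 h2; rewrite /b /c => h1 h2; apply/andP; split; lra.
Qed.

Lemma is_derive_quadratic (V : normedModType R) (x : R -> V) (s d K : R) (D : V) :
  0 < d -> (forall t, `|t - s| < d ->
     `|x t - x s - (t - s) *: D| <= K * `|t - s| ^+ 2) ->
  is_derive s (1 : R) x D.
Proof.
move=> d0 h.
have H : (fun h => h^-1 *: ((x \o shift s) (h *: (1 : R)) - x s)) @ 0^' --> D.
  apply/cvgrPdist_le => e e0.
  have K1 : 0 < `|K| + 1 by rewrite ltr_wpDl.
  near=> t.
  have t0 : t != 0 by near: t; exact: nbhs_dnbhs_neq.
  have td : `|t| < d by near: t; exact: dnbhs0_lt.
  have te : `|t| < e / (`|K| + 1) by near: t; apply: dnbhs0_lt; rewrite divr_gt0.
  have := h (t + s); rewrite addrK => /(_ td) hh.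
  have -> : D - t^-1 *: ((x \o shift s) (t *: (1 : R)) - x s) =
            - (t^-1 *: (x (t + s) - x s - t *: D)).
    rewrite /= [t *: 1]mulr1 [in RHS]scalerBr scalerA mulVf // scale1r.
    by rewrite opprB.
  rewrite normrN normrZ normfV ler_pdivrMl ?normr_gt0 // (le_trans hh) //.
  rewrite expr2 mulrA mulrC ler_wpM2l //.
  apply: (@le_trans _ _ (`|K| * `|t|)); first by rewrite ler_wpM2r // ler_norm.
  move: te; rewrite ltr_pdivlMr // mulrDr mulr1 => te; rewrite mulrC ltW //.
  by apply: le_lt_trans te; rewrite lerDl.
by apply: DeriveDef; [apply/cvg_ex; exists D|exact/cvg_lim].
Unshelve. all: by end_near. Qed.

(** The integral starts to the left of the interval, so no oriented integral is
    needed on either side of 0; stopping the variable at the ends of the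
    interval extends the primitive to a continuous function on the line. *)
Lemma primitive (f : R -> R) (d : R) : 0 < d -> continuous f ->
  exists G : R -> R, [/\ continuous G, G 0 = 0 &
    forall t, `|t| < d -> is_derive t (1 : R) G (f t)].
Proof.
move=> d0 cf; pose a := d + 1; pose b := a + 1.
have fi : (@lebesgue_measure R).-integrable `[- a, b] (EFin \o f).
  apply: continuous_compact_integrable; first exact: segment_compact.
  exact: continuous_subspaceT.
pose F x := (\int[@lebesgue_measure R]_(t in [set` `[- a, x]]) f t)%R.
have dF t : - a < t -> t < b -> is_derive t (1 : R) F (f t).
  move=> t1 t2; have [h1 h2] := continuous_FTC1_closed t2 fi t1 (cf t).
  apply: DeriveDef; first exact: h1.
  exact: etrans (esym (derive1E _ _)) h2.
pose cl t : R := Num.max (- d) (Num.min d t).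
have clI t : - d <= cl t <= d.
  by rewrite le_max lexx /= ge_max ge_min lexx andbT; lra.
have clE t : `|t| < d -> cl t = t.
  by rewrite ltr_norml /cl => /andP[t1 t2]; rewrite (min_r (ltW t2)) (max_r (ltW t1)).
have ccl : continuous cl.
  move=> t; apply: (@continuous_max _ _ (cst (- d)) (fun t => Num.min d t)).
    exact: cst_continuous.
  by apply: (@continuous_min _ _ (cst d) id) => //; exact: cst_continuous.
exists (fun t => F (cl t) - F 0); split.
- move=> t; apply: (@continuousB _ _ _ (F \o cl) (cst (F 0))); last exact: cst_continuous.
  apply: continuous_comp; first exact: ccl.
  have /andP[c1 c2] := clI t.
  have [//|//|dc _] := dF (cl t); rewrite ?/b /a; [lra|lra|].
  by apply: differentiable_continuous; apply/derivable1_diffP.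
- by rewrite clE ?subrr // normr0.
move=> t td.
have E : \near t, F t - F 0 = F (cl t) - F 0.
  have : \forall u \near t, `|u| < d.
    apply: (@open_nbhs_nbhs _ t); split => //.
    apply: (@open_comp _ _ (fun u : R => `|u|) [set v | v < d]).
      by move=> u _; exact: norm_continuous.
    exact: open_lt.
  by apply: filterS => u ud; rewrite clE.
apply: (near_eq_is_derive E).
have h : is_derive t (1 : R) F (f t).
  by move: td; rewrite ltr_norml => /andP[t1 t2]; apply: dF; rewrite ?/b /a; lra.
by rewrite -[f t]subr0; apply: (@is_deriveB _ _ _ F (cst (F 0))).
Qed.

End RowNorm.

(** * Existence for Lipschitz fields *)

Lemma lipschitz_continuous (R : realType) (V W : normedModType R) (F : V -> W)
    (L : R) : 0 <= L -> (forall y z, `|F y - F z| <= L * `|y - z|) ->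
  continuous F.
Proof.
move=> L0 F_lip y; apply/cvgrPdist_le => e e0.
have L1 : 0 < L + 1 by rewrite ltr_wpDl.
have e1 : 0 < e / (L + 1) by rewrite divr_gt0.
have hy : \forall z \near y, `|y - z| <= e / (L + 1).
  exact: (cvgrPdist_le id y).1 cvg_id _ e1.
apply: (@filterS _ (nbhs y) _ _ _ _ hy) => z /= hz.
apply: (le_trans (F_lip _ _)).
move: hz; rewrite ler_pdivlMr // => h; apply: le_trans h; rewrite mulrC ler_wpM2l //.
by rewrite lerDl.
Qed.

Section Picard.
Variables (R : realType) (m : nat) (F : 'rV[R]_m -> 'rV[R]_m) (L d : R)
  (y0 : 'rV[R]_m).
Hypotheses (L0 : 0 <= L) (F_lip : forall y z, `|F y - F z| <= L * `|y - z|)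
  (d0 : 0 < d) (dL : d * L <= 1 / 2).

(** The relation u' = y0 + int F(u), stated through derivatives: a next iterate
    is a primitive, known only on the interval of radius d. *)
Definition picard_step (u u' : R -> 'rV[R]_m) :=
  u' 0 = y0 /\ forall t, `|t| < d -> forall i,
    is_derive t (1 : R) (fun s => u' s 0 i) (F (u t) 0 i).

Lemma picard_step_ex (u : R -> 'rV[R]_m) : continuous u ->
  exists u', continuous u' /\ picard_step u u'.
Proof.
move=> cu.
have h i : exists G : R -> R, [/\ continuous G, G 0 = 0 &
    forall t, `|t| < d -> is_derive t (1 : R) G (F (u t) 0 i)].
  apply: primitive => // t.
  apply: (@continuous_comp _ _ _ u (fun y => F y 0 i)); first exact: cu.
  apply: (@continuous_comp _ _ _ F (fun y => y 0 i)); last exact: coord_continuous.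
  exact: (lipschitz_continuous L0 F_lip).
have [G hG] := choice h.
exists (fun t => \row_i (y0 0 i + G i t)); split; last split.
- move=> t; apply: rV_continuous => i.
  have -> : (fun t => (\row_i (y0 0 i + G i t)) 0 i) = cst (y0 0 i) + G i.
    by apply/funext => s; rewrite mxE.
  apply: continuousD; first exact: cst_continuous.
  by have [cG _ _] := hG i; exact: cG.
- by apply/rowP => i; rewrite mxE; have [_ -> _] := hG i; rewrite addr0.
move=> t td i.
have -> : (fun t => (\row_i (y0 0 i + G i t)) 0 i) = cst (y0 0 i) + G i.
  by apply/funext => s; rewrite mxE.
have [_ _ dG] := hG i; have dGt := dG t td.
by rewrite -[F _ _ _]add0r; apply: is_deriveD.
Qed.

Lemma picard_sequence : exists u : nat -> R -> 'rV[R]_m,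
  u 0%N = cst y0 /\ forall k, picard_step (u k) (u k.+1).
Proof.
have h (u : {u : R -> 'rV[R]_m | continuous u}) :
    exists u' : {u : R -> 'rV[R]_m | continuous u}, picard_step (sval u) (sval u').
  have [u' [cu' pu']] := picard_step_ex (svalP u).
  by exists (exist _ u' cu').
have [next hnext] := choice h.
have c0 : continuous (cst y0 : R -> 'rV[R]_m) by exact: cst_continuous.
pose v k := iter k next (exist (fun u : R -> 'rV[R]_m => continuous u) (cst y0) c0).
by exists (fun k => sval (v k)); split => // k; exact: hnext.
Qed.

(** As d L <= 1/2, each iteration halves the distance of two successive
    iterates, so they converge. The limit is not differentiated under an
    integral: the mean value theorem for the iterates gives, in the limit,
    x t - x s = (t - s) F (x s) up to an error quadratic in t - s. *)
Theorem picard_lindelof : exists x : R -> 'rV[R]_m, x 0 = y0 /\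
  forall t, `|t| < d -> is_derive t (1 : R) x (F (x t)).
Proof.
have [u [u0 hu]] := picard_sequence.
pose C := d * `|F y0|.
have C0 : 0 <= C by rewrite mulr_ge0 // ltW.
pose w k : R := C / 2 ^+ k.
have w0 k : 0 <= w k by rewrite divr_ge0 // exprn_ge0.
have wS k : w k = 2 * w k.+1.
  by rewrite /w exprS invfM [RHS]mulrCA mulVKf // pnatr_eq0.
have d00 : `|0 : R| < d by rewrite normr0.
have step k t : `|t| < d -> `|u k.+1 t - u k t| <= w k.
  elim: k t => [|k IH] t td; apply: rV_norm_le => // i; rewrite !mxE.
    have [c [cd ct E]] := MVT_sym d00 td (fun s sd => (hu 0%N).2 s sd i).
    move: E; rewrite (hu 0%N).1 u0 /cst => ->.
    rewrite normrM subr0 mulrC /w expr0 divr1 /C ler_pM // ?(ltW td) //.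
    exact: rV_coord_le.
  have [c [cd ct E]] := @MVT_sym R d 0 t (fun s => u k.+2 s 0 i - u k.+1 s 0 i)
    (fun s => F (u k.+1 s) 0 i - F (u k s) 0 i) d00 td
    (fun s sd => is_deriveB ((hu k.+1).2 s sd i) ((hu k).2 s sd i)).
  move: E; rewrite (hu k).1 (hu k.+1).1 !subrr !subr0 => ->.
  rewrite normrM.
  have h1 : `|F (u k.+1 c) 0 i - F (u k c) 0 i| <= L * w k.
    have := rV_coord_le (F (u k.+1 c) - F (u k c)) i; rewrite !mxE => /le_trans; apply.
    apply: (le_trans (F_lip _ _)); rewrite ler_wpM2l //; exact: IH.
  apply: (@le_trans _ _ (L * w k * d)).
    by rewrite ler_pM // ltW.
  rewrite [w k]wS.
  have -> : L * (2 * w k.+1) * d = (d * L) * (2 * w k.+1) by ring.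
  apply: (@le_trans _ _ (1 / 2 * (2 * w k.+1))).
    by rewrite ler_wpM2r // mulr_ge0.
  by rewrite mulrA divfK ?mul1r // pnatr_eq0.
have lim_ex (ti : R * 'I_m) : exists l, `|ti.1| < d ->
    forall k, `|u k ti.1 0 ti.2 - l| <= 2 * C / 2 ^+ k.
  have [td|td] := boolP (`|ti.1| < d); last by exists 0.
  have [|l hl] := @geometric_limit R (fun k => u k ti.1 0 ti.2) C.
    move=> k; have := rV_coord_le (u k.+1 ti.1 - u k ti.1) ti.2; rewrite !mxE.
    by move=> /le_trans; apply; exact: step.
  by exists l.
have [l hl] := choice lim_ex.
(* The value at 0 is common to all iterates. *)
pose x t : 'rV[R]_m := if t == 0 then y0 else \row_i l (t, i).
have xu t k : `|t| < d -> `|u k t - x t| <= 2 * w k.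
  move=> td; rewrite /x; case: ifPn => [/eqP ->|_].
    case: k => [|k]; last rewrite (hu k).1.
      by rewrite u0 subrr normr0 mulr_ge0.
    by rewrite subrr normr0 mulr_ge0.
  apply: rV_norm_le => [|i]; first by rewrite mulr_ge0.
  by rewrite !mxE /w mulrA; exact: (hl (t, i) td k).
exists x; split; first by rewrite /x eqxx.
(* A bound for the speed of all iterates, which stay within 4 C of y0. *)
pose M := `|F y0| + 4 * L * C.
have M0 : 0 <= M by rewrite addr_ge0 // mulr_ge0 // mulr_ge0.
have w0C : w 0%N = C by rewrite /w expr0 divr1.
have wC k : w k <= C.
  rewrite /w ler_pdivrMr ?exprn_gt0 // ler_peMr //.
  by rewrite exprn_ege1 // ler1n.
have FM k t : `|t| < d -> `|F (u k t)| <= M.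
  move=> td; rewrite -(subrK (F y0) (F (u k t))).
  apply: (le_trans (ler_normD _ _)); rewrite addrC lerD2l.
  apply: (le_trans (F_lip _ _)); have -> : 4 * L * C = L * (4 * C) by ring.
  rewrite ler_wpM2l //.
  have := ler_normD (u k t - x t) (x t - y0); rewrite subrKA => h.
  have h1 := xu t k td; have h2 := xu t 0%N td.
  rewrite u0 /cst distrC w0C in h2.
  by have := wC k; lra.
have x_lip t s i : `|t| < d -> `|s| < d -> `|x t 0 i - x s 0 i| <= M * `|t - s|.
  move=> td sd; apply: (@le_of_geometric R _ _ (2 * C)) => k.
  have [c [cd ct E]] := MVT_sym sd td (fun s sd => (hu k).2 s sd i).
  have h1 := le_trans (rV_coord_le _ i) (xu t k.+1 td); rewrite !mxE in h1.
  have h2 := le_trans (rV_coord_le _ i) (xu s k.+1 sd); rewrite !mxE in h2.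
  have h3 : `|u k.+1 t 0 i - u k.+1 s 0 i| <= M * `|t - s|.
    rewrite E normrM ler_wpM2r //; apply: le_trans (FM k c cd); exact: rV_coord_le.
  have -> : 2 * C / 2 ^+ k = 2 * w k by rewrite /w mulrA.
  rewrite (wS k); move: h1 h2 h3; rewrite !ler_norml => /andP[? ?] /andP[? ?] /andP[? ?].
  by apply/andP; split; lra.
move=> s sd.
apply: (@is_derive_quadratic R _ x s (d - `|s|) (L * M)); first by rewrite subr_gt0.
move=> t; rewrite ltrBrDl => ts.
have td : `|t| < d.
  by apply: le_lt_trans ts; rewrite -{1}(subrK s t) addrC ler_normD.
apply: rV_norm_le => [|i]; first by rewrite !mulr_ge0 // exprn_ge0.
rewrite !mxE.
apply: (@le_of_geometric R _ _ ((2 * L * d * 2 + 4) * C)) => k.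
have [c [cd ct E]] := MVT_sym sd td (fun s sd => (hu k).2 s sd i).
have h1 := le_trans (rV_coord_le _ i) (xu t k.+1 td); rewrite !mxE in h1.
have h2 := le_trans (rV_coord_le _ i) (xu s k.+1 sd); rewrite !mxE in h2.
have -> : (2 * L * d * 2 + 4) * C / 2 ^+ k = (2 * L * d * 2 + 4) * w k by rewrite /w mulrA.
have h3 : `|u k.+1 t 0 i - u k.+1 s 0 i - (t - s) * F (x s) 0 i| <=
    L * (2 * w k + M * `|t - s|) * `|t - s|.
  rewrite E [(t - s) * _]mulrC -mulrBl normrM ler_wpM2r //.
  have := rV_coord_le (F (u k c) - F (x s)) i; rewrite !mxE => /le_trans; apply.
  apply: (le_trans (F_lip _ _)); rewrite ler_wpM2l //.
  apply: rV_norm_le => [|j]; first by apply: addr_ge0; apply: mulr_ge0.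
  rewrite !mxE -(subrKA (x c 0 j)); apply: (le_trans (ler_normD _ _)); apply: lerD.
    by have := le_trans (rV_coord_le _ j) (xu c k cd); rewrite !mxE.
  by apply: (le_trans (x_lip c s j cd sd)); rewrite ler_wpM2l.
have h4 : L * (2 * w k + M * `|t - s|) * `|t - s| <=
    L * M * `|t - s| ^+ 2 + 2 * L * d * 2 * w k.
  have -> : L * (2 * w k + M * `|t - s|) * `|t - s| =
    2 * L * w k * `|t - s| + L * M * `|t - s| ^+ 2 by rewrite expr2; ring.
  rewrite addrC lerD2l.
  have -> : 2 * L * d * 2 * w k = 2 * L * w k * (d * 2) by ring.
  apply: ler_wpM2l; first by apply: mulr_ge0 => //; apply: mulr_ge0.
  have := ler_normD t (- s); rewrite normrN => h; apply: (le_trans h).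
  by rewrite mulr_natr mulr2n lerD // ltW.
rewrite mulrDl addrA.
have := wS k; move: (le_trans h3 h4) h1 h2.
rewrite !ler_norml /GRing.scale /= => /andP[? ?] /andP[? ?] /andP[? ?] ?.
by apply/andP; split; lra.
Qed.

End Picard.

(** * Local solutions of smooth differential equations *)

Section LocalFlow.
Variables (R : realType) (m : nat).
Local Notation E := 'rV[R]_m.

Lemma derive_row_sum (W : normedModType R) (f : E -> W) x v :
  differentiable f x ->
  'D_v f x = \sum_i v 0 i *: 'D_(delta_mx 0 i) f x.
Proof.
move=> df; rewrite (deriveE _ df) {1}[v]row_sum_delta linear_sum.
by apply: eq_bigr => i _; rewrite linearZ (deriveE _ df).
Qed.

(** The partial derivatives are bounded near y0; the mean value theorem along
    segments of a box, which is convex, turns the bound into a Lipschitz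
    constant. *)
Lemma local_lipschitz (U : set E) (F : E -> E) (y0 : E) :
  open U -> U y0 -> Ck U 1 F ->
  exists r L, [/\ 0 < r, 0 <= L, forall y, `|y - y0| <= r -> U y &
    forall y z, `|y - y0| <= r -> `|z - y0| <= r -> `|F y - F z| <= L * `|y - z|].
Proof.
move=> oU Uy0 /(Ck_mxP oU) hF.
pose D k i := 'D_(delta_mx 0 i) (fun y => F y 0 k).
pose K k i := `|D k i y0| + 1.
have K0 k i : 0 <= K k i by rewrite addr_ge0.
have near_K k i : \forall y \near y0, `|D k i y| <= K k i.
  have cD : {for y0, continuous (D k i)}.
    by apply: differentiable_continuous; exact: ((hF 0 k).2 (delta_mx 0 i)).1.
  have h : \forall y \near y0, `|D k i y0 - D k i y| <= 1.
    exact: (cvgrPdist_le _ _).1 cD _ ltr01.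
  apply: filterS h => y hy; rewrite /K.
  rewrite -(subKr (D k i y0) (D k i y)) (le_trans (ler_normB _ _)) //.
  by rewrite lerD2l.
have H : \forall y \near y0, U y /\ forall k i, `|D k i y| <= K k i.
  have h1 : \forall y \near y0, forall k i, `|D k i y| <= K k i.
    have h0 k : \forall y \near y0, forall i, `|D k i y| <= K k i.
      exact: filter_forall (near_K k).
    exact: filter_forall h0.
  exact: filterI (near_open oU Uy0) h1.
move/nbhs_ballP : H => [r /= r0 hr].
pose L := \sum_k \sum_i K k i.
have L0 : 0 <= L by apply: sumr_ge0 => k _; apply: sumr_ge0.
have hr' y : `|y - y0| <= r / 2 -> ball y0 r y.
  move=> h; rewrite -ball_normE /= distrC (le_lt_trans h) //.
  by rewrite ltr_pdivrMr // mulr_natr mulr2n ltrDl.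
exists (r / 2), L; split => //.
- by rewrite divr_gt0.
- by move=> y /hr'/hr[].
move=> z y hz hy.
apply: rV_norm_le => [|k]; first exact: mulr_ge0.
have seg (s : R) : 0 <= s <= 1 -> `|y + s *: (z - y) - y0| <= r / 2.
  move=> /andP[s0 s1].
  have -> : y + s *: (z - y) - y0 = (1 - s) *: (y - y0) + s *: (z - y0).
    by apply/rowP => i; rewrite !mxE; ring.
  apply: (le_trans (ler_normD _ _)); rewrite !normrZ.
  rewrite (ger0_norm s0) ger0_norm ?subr_ge0 //.
  have h1 : (1 - s) * `|y - y0| <= (1 - s) * (r / 2) by rewrite ler_wpM2l // subr_ge0.
  have h2 : s * `|z - y0| <= s * (r / 2) by rewrite ler_wpM2l.
  by lra.
have dfk (s : R) : 0 <= s <= 1 -> differentiable (fun y => F y 0 k) (y + s *: (z - y)).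
  by move=> /seg/hr'/hr[Us _]; exact: (Ck_differentiable (hF 0 k) Us).
have [s sI] := MVT_line ltr01 dfk.
have yz : y + (z - y) = z by rewrite addrC subrK.
rewrite scale1r yz mulr1 !mxE => ->.
have [_ hK] := hr _ (hr' _ (seg s sI)).
rewrite (derive_row_sum _ (dfk s sI)).
apply: (le_trans (ler_norm_sum _ _ _)).
apply: (@le_trans _ _ (\sum_i K k i * `|z - y|)).
  apply: ler_sum => i _; rewrite normrM mulrC ler_pM //; first exact: hK.
  exact: rV_coord_le.
rewrite -mulr_suml ler_wpM2r // /L [leRHS](bigD1 k) //= lerDl.
by apply: sumr_ge0 => k' _; apply: sumr_ge0.
Qed.

(** Composing with this retraction onto a box, which does not increase
    distances, turns a field that is Lipschitz on the box into a globally
    Lipschitz one. *)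
Definition box_retract (y0 : E) (r : R) (y : E) : E :=
  \row_i (y0 0 i + Num.max (- r) (Num.min r (y 0 i - y0 0 i))).

Lemma box_retract_in y0 r y : 0 <= r -> `|box_retract y0 r y - y0| <= r.
Proof.
move=> r0; apply: rV_norm_le => // i; rewrite !mxE addrC addKr ler_norml.
by rewrite le_max lexx /= ge_max ge_min lexx andbT; lra.
Qed.

Lemma box_retract_id y0 r y : `|y - y0| <= r -> box_retract y0 r y = y.
Proof.
move=> h; apply/rowP => i; rewrite !mxE.
have := le_trans (rV_coord_le (y - y0) i) h; rewrite !mxE ler_norml => /andP[h1 h2].
by rewrite min_r // max_r // addrC subrK.
Qed.

Lemma box_retract_lip y0 r y z :
  `|box_retract y0 r y - box_retract y0 r z| <= `|y - z|.
Proof.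
apply: rV_norm_le => // i; apply: le_trans (rV_coord_le (y - z) i).
rewrite !mxE; set a := y 0 i; set b := z 0 i; set c := y0 0 i.
have -> : a - b = (a - c) - (b - c) by ring.
move: (a - c) (b - c) => p q.
have -> (s t : R) : c + s - (c + t) = s - t by ring.
have key p' q' : Num.max (- r) (Num.min r p') - Num.max (- r) (Num.min r q') <=
    `|p' - q'|.
  have h1 := ler_norm (p' - q'); have h2 := normr_ge0 (p' - q').
  have h3 : Num.min r p' - Num.min r q' <= `|p' - q'|.
    by case: (leP r p'); case: (leP r q') => h4 h5; lra.
  move: (Num.min r p') (Num.min r q') h3 => u v h3.
  by case: (leP (- r) u); case: (leP (- r) v) => h4 h5; lra.
rewrite ler_norml key andbT; have := key q p; rewrite distrC => h.
by rewrite lerNl opprB.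
Qed.

(** A solution for the field composed with the retraction stays in the box for
    a short time, and there solves the original equation. *)
Lemma ode_local (U : set E) (F : E -> E) (y0 : E) :
  open U -> U y0 -> Ck U 1 F ->
  exists d (x : R -> E), [/\ 0 < d, x 0 = y0 &
    forall t, `|t| < d -> U (x t) /\ is_derive t (1 : R) x (F (x t))].
Proof.
move=> oU Uy0 hF; have [r [L [r0 L0 rU lipF]]] := local_lipschitz oU Uy0 hF.
pose G y := F (box_retract y0 r y).
have lipG y z : `|G y - G z| <= L * `|y - z|.
  apply: (le_trans (lipF _ _ (box_retract_in _ _ (ltW r0)) (box_retract_in _ _ (ltW r0)))).
  by rewrite ler_wpM2l // box_retract_lip.
(* With L + 1 in place of L, which may be 0. *)
pose d := (2 * (L + 1))^-1.
have L1 : 0 < L + 1 by rewrite ltr_wpDl.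
have d0 : 0 < d by rewrite invr_gt0 mulr_gt0.
have dL : d * L <= 1 / 2.
  rewrite /d mulrC ler_pdivrMr ?mulr_gt0 // mulrA divfK ?pnatr_eq0 // mul1r.
  by rewrite lerDl.
have [x [x0 dx]] := picard_lindelof y0 L0 lipG d0 dL.
have cx : {for 0, continuous x}.
  have [dx0 _] := dx 0 (ltac:(by rewrite normr0)).
  by apply: differentiable_continuous; apply/derivable1_diffP.
have : \forall t \near (0 : R), `|x 0 - x t| <= r by exact: (cvgrPdist_le _ _).1 cx _ r0.
move/nbhs_ballP => [e /= e0 he].
exists (Num.min d e), x; split => //; first by rewrite lt_min d0.
move=> t; rewrite lt_min => /andP[td te].
have xr : `|x t - y0| <= r.
  by rewrite distrC -x0; apply: he; rewrite -ball_normE /= sub0r normrN.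
split; first exact: rU.
by have := dx t td; rewrite /G box_retract_id.
Qed.

(** Bootstrapping: x' = F(x), so x is one order smoother than F(x), which is as
    smooth as x. *)
Lemma ode_smooth (U : set E) (F : E -> E) (I : set R) (x : R -> E) :
  open U -> open I -> smooth_on U F ->
  (forall t, I t -> U (x t) /\ is_derive t (1 : R) x (F (x t))) ->
  smooth_on I x.
Proof.
move=> oU oI /smooth_onP sF hx; apply/smooth_onP => k.
have dx t : I t -> differentiable x t.
  by move=> /hx[_ [h _]]; apply/derivable1_diffP.
elim: k => [|k IH]; first by split.
split => // v.
have cl : continuous ( *:%R v : E -> E) by exact: scaler_continuous.
have h := Ck_comp oI oU (fun t It => (hx t It).1) (sF k) IH.
apply: (Ck_eq oI (f := fun t => v *: F (x t))); last first.
  by apply: (Ck_linear oI (l := *:%R v)) h.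
move=> t /set_mem It.
have [_ [h1 h2]] := hx t It.
rewrite -h2 (deriveE _ (dx t It)) (deriveE _ (dx t It)) -linearZ /=.
by rewrite [v *: 1]mulr1.
Qed.

End LocalFlow.

(** * Derivatives of matrix products *)

Section MatrixCalculus.
Variables (R : realType) (V : normedModType R).

Lemma differentiable_mxP m n (f : V -> 'M[R]_(m, n)) x :
  differentiable f x <-> forall i j, differentiable (fun y => f y i j) x.
Proof.
split=> [df i j|h].
  exact: (differentiable_comp (g := fun N : 'M[R]_(m, n) => N i j) df
    (differentiable_coord _ i j)).
have -> : f = \sum_i \sum_j (fun y => f y i j *: delta_mx i j).
  apply/funext => y; rewrite [LHS]matrix_sum_delta fct_sumE.
  by apply: eq_bigr => i _; rewrite fct_sumE.
apply: differentiable_sum => i; apply: differentiable_sum => j.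
by apply: (differentiableZl (k := fun y => f y i j)).
Qed.

Lemma derive_coord m n (f : V -> 'M[R]_(m, n)) x v i j :
  differentiable f x -> 'D_v f x i j = 'D_v (fun y => f y i j) x.
Proof. by move=> df; rewrite derive_mx ?mxE //; exact: diff_derivable. Qed.

Lemma derive_sum_fun (W : normedModType R) n (f : 'I_n -> V -> W) x v :
  (forall i, differentiable (f i) x) ->
  'D_v (fun y => \sum_i f i y) x = \sum_i 'D_v (f i) x.
Proof.
move=> df; have -> : (fun y => \sum_i f i y) = \sum_i f i.
  by apply/funext => y; rewrite fct_sumE.
by rewrite derive_sum // => i; exact: diff_derivable.
Qed.

Lemma differentiable_sum_fun (W : normedModType R) n (f : 'I_n -> V -> W) x :
  (forall i, differentiable (f i) x) ->
  differentiable (fun y => \sum_i f i y) x.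
Proof.
move=> df; have -> : (fun y => \sum_i f i y) = \sum_i f i.
  by apply/funext => y; rewrite fct_sumE.
exact: differentiable_sum.
Qed.

Lemma derive_mul_fun (f g : V -> R) x v :
  differentiable f x -> differentiable g x ->
  'D_v (fun y => f y * g y) x = 'D_v f x * g x + f x * 'D_v g x.
Proof.
move=> df dg; rewrite (@deriveM _ _ f g _ _ (diff_derivable df) (diff_derivable dg)).
by rewrite addrC /GRing.scale /=; congr (_ + _); rewrite mulrC.
Qed.

Lemma differentiable_mulmx m n p (A : V -> 'M[R]_(m, n)) (B : V -> 'M[R]_(n, p)) x :
  differentiable A x -> differentiable B x ->
  differentiable (fun y => A y *m B y) x.
Proof.
move=> /differentiable_mxP dA /differentiable_mxP dB.
apply/differentiable_mxP => i k.
have -> : (fun y => (A y *m B y) i k) = (fun y => \sum_j A y i j * B y j k).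
  by apply/funext => y; rewrite mxE.
apply: differentiable_sum_fun => j.
exact: (@differentiableM _ _ (fun y => A y i j) (fun y => B y j k)).
Qed.

Lemma derive_mulmx m n p (A : V -> 'M[R]_(m, n)) (B : V -> 'M[R]_(n, p)) x v :
  differentiable A x -> differentiable B x ->
  'D_v (fun y => A y *m B y) x = 'D_v A x *m B x + A x *m 'D_v B x.
Proof.
move=> dA dB; apply/matrixP => i k.
rewrite (derive_coord _ _ _ (differentiable_mulmx dA dB)) !mxE.
have -> : (fun y => (A y *m B y) i k) = (fun y => \sum_j A y i j * B y j k).
  by apply/funext => y; rewrite mxE.
have dA' i' j := (differentiable_mxP A x).1 dA i' j.
have dB' i' j := (differentiable_mxP B x).1 dB i' j.
rewrite derive_sum_fun; last first.
  by move=> j; exact: (@differentiableM _ _ (fun y => A y i j) (fun y => B y j k)).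
rewrite -big_split /=; apply: eq_bigr => j _.
by rewrite derive_mul_fun // !derive_coord.
Qed.

Lemma differentiable_trmx m n (A : V -> 'M[R]_(m, n)) x :
  differentiable A x -> differentiable (fun y => (A y)^T) x.
Proof.
move=> /differentiable_mxP dA; apply/differentiable_mxP => i j.
have -> : (fun y => (A y)^T i j) = (fun y => A y j i).
  by apply/funext => y; rewrite mxE.
exact: dA.
Qed.

Lemma derive_trmx m n (A : V -> 'M[R]_(m, n)) x v :
  differentiable A x -> 'D_v (fun y => (A y)^T) x = ('D_v A x)^T.
Proof.
move=> dA; apply/matrixP => i j.
rewrite (derive_coord _ _ _ (differentiable_trmx dA)) mxE (derive_coord _ _ _ dA).
by congr ('D_v _ x); apply/funext => y; rewrite mxE.
Qed.

Lemma derive_cst_mulmx m n p (u : 'M[R]_(m, n)) (A : V -> 'M[R]_(n, p)) x v :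
  differentiable A x -> 'D_v (fun y => u *m A y) x = u *m 'D_v A x.
Proof.
move=> dA; have dc : differentiable (cst u : V -> _) x by exact: differentiable_cst.
by rewrite (derive_mulmx v dc dA) derive_cst mul0mx add0r.
Qed.

End MatrixCalculus.

(** The matrix of the differential, acting on row vectors from the right. It is
    given by directional derivatives, also where f is not differentiable, so
    that its smoothness is that of those derivatives. *)
Definition jac (R : realType) n m (f : 'rV[R]_n -> 'rV[R]_m) (x : 'rV[R]_n) :
  'M[R]_(n, m) := \matrix_(i, j) ('D_(delta_mx 0 i) f x) 0 j.

Lemma derive_jac (R : realType) n m (f : 'rV[R]_n -> 'rV[R]_m) x v :
  differentiable f x -> 'D_v f x = v *m jac f x.
Proof.
move=> df; rewrite (derive_row_sum _ df); apply/rowP => j.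
by rewrite summxE mxE; apply: eq_bigr => i _; rewrite !mxE.
Qed.

Section Jac.
Variables (R : realType) (n m : nat).
Implicit Types (f : 'rV[R]_n -> 'rV[R]_m) (x v : 'rV[R]_n).

Lemma jac_comp p f (h : 'rV[R]_m -> 'rV[R]_p) x :
  differentiable f x -> differentiable h (f x) ->
  jac (h \o f) x = jac f x *m jac h (f x).
Proof.
move=> df dh; apply/row_matrixP => i.
have rE q (k : 'rV[R]_n -> 'rV[R]_q) : row i (jac k x) = 'D_(delta_mx 0 i) k x.
  by apply/rowP => j; rewrite !mxE.
rewrite rE row_mul rE -(derive_jac _ dh).
rewrite (deriveE _ (differentiable_comp df dh)) (diff_comp df dh) /=.
by rewrite (deriveE _ df) (deriveE _ dh).
Qed.

Lemma jac_near f h x : (\near x, f x = h x) -> jac f x = jac h x.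
Proof. by move=> fh; apply/matrixP => i j; rewrite !mxE (near_eq_derive _ fh). Qed.

Lemma jac_Ck (U : set 'rV[R]_n) k f : open U -> Ck U k.+1 f -> Ck U k (jac f).
Proof.
move=> oU [_ hf]; apply/(Ck_mxP oU) => i j.
apply: (Ck_eq oU (f := fun x => 'D_(delta_mx 0 i) f x 0 j)).
  by move=> x _; rewrite mxE.
by move/(Ck_mxP oU) : (hf (delta_mx 0 i)); apply.
Qed.

End Jac.

Lemma jac_id (R : realType) n (x : 'rV[R]_n) : jac id x = 1%:M.
Proof.
by apply/matrixP => i j; rewrite !mxE derive_id !mxE eqxx /= eq_sym.
Qed.

(** Both sides are second derivatives of f along v and w, in opposite orders. *)
Lemma jac_derive_sym (R : realType) n m (U : set 'rV[R]_n)
    (f : 'rV[R]_n -> 'rV[R]_m) x v w : open U -> U x -> Ck U 2 f ->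
  v *m 'D_w (jac f) x = w *m 'D_v (jac f) x.
Proof.
move=> oU Ux hf.
have dj : differentiable (jac f) x by exact: (Ck_differentiable (jac_Ck oU hf) Ux).
have key u u' : u *m 'D_u' (jac f) x = 'D_u' ('D_u f) x.
  rewrite -(derive_cst_mulmx _ _ dj); apply: near_eq_derive.
  apply: filterS (near_open oU Ux) => y Uy.
  by rewrite derive_jac //; exact: (Ck_differentiable hf Uy).
rewrite !key; apply/rowP => j.
have hfj : Ck U 2 (fun y => f y 0 j) by move/(Ck_mxP oU) : hf; apply.
have d2 u u' : ('D_u' ('D_u f) x) 0 j = 'D_u' ('D_u (fun y => f y 0 j)) x.
  rewrite (derive_coord _ _ _ ((hf.2 u).1 _ Ux)); apply: near_eq_derive.
  apply: filterS (near_open oU Ux) => y Uy.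
  by rewrite (derive_coord _ _ _ (Ck_differentiable hf Uy)).
apply: (etrans (d2 v w)); apply: (etrans _ (esym (d2 w v))).
exact: (derive_symmetric v w oU Ux hfj).
Qed.

(** * Transition maps *)
Section Charts.
Variables (R : realType) (n : nat) (M : topologicalType) (D : manifold R n M).
Implicit Types phi psi chi : chart R n M.

Definition overlap phi psi : set 'rV[R]_n := cmap phi @` (cdom phi `&` cdom psi).

Definition transition phi psi : 'rV[R]_n -> 'rV[R]_n := cmap psi \o cinv phi.

Lemma cinvP phi x : (cmap phi @` cdom phi) x ->
  cdom phi (cinv phi x) /\ cmap phi (cinv phi x) = x.
Proof. by move=> [p pd <-]; rewrite cmapK. Qed.

Lemma overlapP phi psi x :
  overlap phi psi x <-> (cmap phi @` cdom phi) x /\ cdom psi (cinv phi x).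
Proof.
split=> [[p [pd pd'] <-]|[xd xd']].
  by rewrite cmapK //; split => //; exists p.
by have [d e] := cinvP xd; exists (cinv phi x).
Qed.

Lemma overlap_cmap phi psi p : cdom phi p -> cdom psi p ->
  overlap phi psi (cmap phi p).
Proof. by move=> h1 h2; exists p. Qed.

Lemma open_overlap phi psi : open (overlap phi psi).
Proof.
rewrite openE => x /overlapP [xd xd'].
have h1 : nbhs x (cmap phi @` cdom phi).
  by apply: open_nbhs_nbhs; split => //; exact: cimg_open.
have h2 : nbhs x (cinv phi @^-1` cdom psi).
  apply: (cinv_continuous xd); apply: open_nbhs_nbhs; split => //.
  exact: cdom_open.
by apply: filterS (filterI h1 h2) => y [y1 y2]; apply/overlapP.
Qed.

Lemma transition_in phi psi x : overlap phi psi x ->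
  overlap psi phi (transition phi psi x).
Proof.
move=> /overlapP [xd xd']; have [d e] := cinvP xd.
by apply: overlap_cmap.
Qed.

Lemma cinv_transition phi psi x : overlap phi psi x ->
  cinv psi (transition phi psi x) = cinv phi x.
Proof. by move=> /overlapP [_ xd]; rewrite /transition /= cmapK. Qed.

Lemma smooth_transition phi psi : atlas D phi -> atlas D psi ->
  smooth_on (overlap phi psi) (transition phi psi).
Proof. exact: (@atlas_compatible _ _ _ D). Qed.

Lemma differentiable_transition phi psi x : atlas D phi -> atlas D psi ->
  overlap phi psi x -> differentiable (transition phi psi) x.
Proof. by move=> hp hq; exact: smooth_on_differentiable (smooth_transition hp hq). Qed.

Lemma jac_transition_comp phi psi chi x :
  atlas D phi -> atlas D psi -> atlas D chi ->
  overlap phi psi x -> cdom chi (cinv phi x) ->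
  jac (transition phi chi) x =
  jac (transition phi psi) x *m jac (transition psi chi) (transition phi psi x).
Proof.
move=> ap aq ac ox cx.
have oc : overlap psi chi (transition phi psi x).
  have /overlapP [h _] := transition_in ox; apply/overlapP; split => //.
  by rewrite cinv_transition.
rewrite -jac_comp; last 2 first.
- exact: differentiable_transition ox.
- exact: differentiable_transition oc.
apply: jac_near; apply: (near_eq_on (open_overlap (phi := phi) (psi := psi)) ox) => y oy.
by rewrite {1}/transition /= -(cinv_transition oy).
Qed.

Lemma jac_transitionK phi psi x : atlas D phi -> atlas D psi ->
  overlap phi psi x ->
  jac (transition phi psi) x *m jac (transition psi phi) (transition phi psi x)
  = 1%:M.
Proof.
move=> ap aq ox; have /overlapP [xd _] := ox; have [xd' e] := cinvP xd.
rewrite -jac_transition_comp // -(jac_id x); apply: jac_near.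
by apply: (near_eq_on (cimg_open (c := phi)) xd) => y /cinvP [].
Qed.

(** * Metrics in charts *)

Variable g : M -> 'M[R]_n.

Lemma metric_in_chartE phi x : (cmap phi @` cdom phi) x ->
  let p := cinv phi x in let J := jac (transition phi (chart_at D p)) x in
  metric_in_chart D g phi x = J *m g p *m J^T.
Proof.
move=> xd p J; have [xd' e] := cinvP xd.
have cE i : coord_vector D phi p i = row i J.
  by rewrite /coord_vector /chart_diff e; apply/rowP => j; rewrite !mxE.
apply/matrixP => i j; rewrite mxE -/p !cE /pairing -row_mul.
by rewrite !mxE; apply: eq_bigr => k _; rewrite !mxE.
Qed.

Lemma metric_transition phi psi x : atlas D phi -> atlas D psi ->
  overlap phi psi x ->
  let J := jac (transition phi psi) x in
  metric_in_chart D g phi x =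
  J *m metric_in_chart D g psi (transition phi psi x) *m J^T.
Proof.
move=> ap aq ox J; have /overlapP [xd _] := ox.
have /overlapP [xd' _] := transition_in ox.
rewrite (metric_in_chartE xd) (metric_in_chartE xd') /=.
rewrite (cinv_transition ox); set c := chart_at D _.
rewrite (jac_transition_comp ap aq (chart_at_atlas D _) ox (chart_at_dom D _)).
by rewrite -/c -/J trmx_mul !mulmxA.
Qed.

Hypothesis hg : pseudo_riemannian D g.

Lemma metric_in_chart_tr phi x :
  (metric_in_chart D g phi x)^T = metric_in_chart D g phi x.
Proof. by apply/matrixP => i j; rewrite mxE; exact: metric_in_chart_sym. Qed.

Lemma metric_in_chart_unit phi x : atlas D phi -> (cmap phi @` cdom phi) x ->
  metric_in_chart D g phi x \in unitmx.
Proof.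
move=> ap xd; rewrite (metric_in_chartE xd) /=.
set c := chart_at D _; set J := jac _ _.
have ox : overlap phi c x by apply/overlapP; split => //; exact: chart_at_dom.
have E := jac_transitionK ap (chart_at_atlas D _) ox.
have [JU _] := mulmx1_unit E.
by have [_ gU _] := hg; rewrite !unitmx_mul unitmx_tr JU gU.
Qed.

Lemma metric_in_chart_differentiable phi x : atlas D phi ->
  (cmap phi @` cdom phi) x -> differentiable (metric_in_chart D g phi) x.
Proof. by case: hg => _ _ h ap xd; exact: smooth_on_differentiable (h _ ap) xd. Qed.

End Charts.

(** * The Euler-Lagrange form of the geodesic equation *)

(** The Euler-Lagrange covector of the energy 1/2 x' G(x) x'^T, paired with w,
    for a curve through x with velocity v and acceleration a. *)
Definition euler_lagrange (R : realType) n (G : 'rV[R]_n -> 'M[R]_n)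
    (x a v w : 'rV[R]_n) : 'M[R]_1 :=
  a *m G x *m w^T + v *m 'D_v G x *m w^T - 2^-1 *: (v *m 'D_w G x *m v^T).

(** In the application A and B are the derivatives along v and w of the Jacobian
    matrix J of a transition map, so the hypothesis v B = w A is the symmetry
    of its second derivatives; with it the terms in B cancel one of those in A,
    and the other one corrects the acceleration. *)
Lemma euler_lagrange_algebra (R : realType) n (a v w : 'rV[R]_n)
    (J H H1 H2 A B : 'M[R]_n) : H^T = H -> v *m B = w *m A ->
  a *m (J *m H *m J^T) *m w^T +
  v *m (A *m H *m J^T + J *m H1 *m J^T + J *m H *m A^T) *m w^T -
  2^-1 *: (v *m (B *m H *m J^T + J *m H2 *m J^T + J *m H *m B^T) *m v^T) =
  (a *m J + v *m A) *m H *m (w *m J)^T + v *m J *m H1 *m (w *m J)^T -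
  2^-1 *: (v *m J *m H2 *m (v *m J)^T).
Proof.
move=> HT sym.
have e1 : v *m (J *m H *m A^T) *m w^T = v *m J *m H *m (v *m B)^T.
  by rewrite sym trmx_mul !mulmxA.
have e2 : v *m (B *m H *m J^T) *m v^T = v *m J *m H *m (v *m B)^T.
  have tr1 (m : 'M[R]_1) : m^T = m by apply/matrixP => i j; rewrite mxE !ord1.
  by rewrite -[LHS]tr1 !trmx_mul !trmxK HT !mulmxA.
have e3 : v *m (J *m H *m B^T) *m v^T = v *m J *m H *m (v *m B)^T.
  by rewrite trmx_mul !mulmxA.
rewrite !mulmxDr !mulmxDl e1 e2 e3 ![(_ *m J)^T]trmx_mul !mulmxA.
set P := v *m J *m H *m (v *m B)^T.
move: (a *m J *m H *m J^T *m w^T) (v *m A *m H *m J^T *m w^T)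
  (v *m J *m H1 *m J^T *m w^T) (v *m J *m H2 *m J^T *m v^T) P => p1 p2 p3 p4 P.
by apply/matrixP => i j; rewrite !mxE; field.
Qed.

(** Covariance of the Euler-Lagrange expression under a change of coordinates T:
    v J and a J + v (D_v J) are the velocity and the acceleration of the image
    curve. *)
Lemma euler_lagrange_transition (R : realType) n (U : set 'rV[R]_n)
    (T : 'rV[R]_n -> 'rV[R]_n) (G H : 'rV[R]_n -> 'M[R]_n) x a v w :
  open U -> U x -> Ck U 2 T -> differentiable H (T x) -> (H (T x))^T = H (T x) ->
  (forall y, U y -> G y = jac T y *m H (T y) *m (jac T y)^T) ->
  let J := jac T x in
  euler_lagrange G x a v w =
  euler_lagrange H (T x) (a *m J + v *m 'D_v (jac T) x) (v *m J) (w *m J).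
Proof.
move=> oU Ux hT dH HT GE J.
have dT : differentiable T x by exact: (Ck_differentiable hT Ux).
have dJ : differentiable (jac T) x by exact: (Ck_differentiable (jac_Ck oU hT) Ux).
have dHT : differentiable (H \o T) x by exact: differentiable_comp.
have dG u : 'D_u G x = 'D_u (jac T) x *m H (T x) *m J^T
    + J *m 'D_(u *m J) H (T x) *m J^T + J *m H (T x) *m ('D_u (jac T) x)^T.
  rewrite (near_eq_derive (g := fun y => jac T y *m (H \o T) y *m (jac T y)^T)); last first.
    exact: (near_eq_on oU Ux GE).
  rewrite (derive_mulmx _ (differentiable_mulmx dJ dHT) (differentiable_trmx dJ)).
  rewrite (derive_mulmx _ dJ dHT) (derive_trmx _ dJ) mulmxDl -/J.
  rewrite (deriveE _ dHT) (diff_comp dT dH) /= -(deriveE _ dT) -(deriveE _ dH).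
  by rewrite (derive_jac _ dT).
have sym := jac_derive_sym v w oU Ux hT.
rewrite /euler_lagrange !dG (GE _ Ux) -/J.
exact: euler_lagrange_algebra.
Qed.

(** * Invariance of the geodesic equation *)

Lemma sum_invmx_mul (R : realType) n (A : 'M[R]_n) (K : 'I_n -> R) m :
  A \in unitmx -> (forall k, A k m = A m k) ->
  \sum_k (\sum_l invmx A k l * K l) * A k m = K m.
Proof.
move=> uA AS.
under eq_bigr => k _ do rewrite mulr_suml.
rewrite exchange_big /=.
transitivity (\sum_l (A *m invmx A) m l * K l).
  apply: eq_bigr => l _; rewrite mxE mulr_suml; apply: eq_bigr => k _.
  by rewrite AS mulrAC [X in X * _]mulrC.
rewrite mulmxV // (bigD1 m) //= mxE eqxx mul1r big1 ?addr0// => l lm.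
by rewrite mxE eq_sym (negbTE lm) mul0r.
Qed.

Section GeodesicEquation.
Variables (R : realType) (n : nat) (M : topologicalType) (D : manifold R n M).
Variables (g : M -> 'M[R]_n) (hg : pseudo_riemannian D g).
Implicit Types phi psi : chart R n M.

Lemma christoffel_lowered phi x i j m :
  let G := metric_in_chart D g phi in
  let d a b c := ('D_(delta_mx 0 a) (fun y => G y b c) x : R) in
  G x \in unitmx ->
  \sum_k christoffel D g phi x k i j * G x k m =
    2^-1 * (d i j m + d j i m - d m i j).
Proof.
move=> G d uG; pose K l := d i j l + d j i l - d l i j.
rewrite -[_ - _]/(K m) -(sum_invmx_mul K uG (fun k => metric_in_chart_sym phi x k m hg)).
rewrite mulr_sumr; apply: eq_bigr => k _; rewrite mulrA; congr (_ * _).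
Qed.

(** In the three terms of the Christoffel symbols, paired with v twice, the first
    two agree. *)
Lemma christoffel_form_lowered phi x v w :
  let G := metric_in_chart D g phi in
  G x \in unitmx -> differentiable G x ->
  christoffel_form D g phi x v v *m G x *m w^T =
  v *m 'D_v G x *m w^T - 2^-1 *: (v *m 'D_w G x *m v^T).
Proof.
move=> G uG dG.
pose d a b c : R := 'D_(delta_mx 0 a) (fun y => G y b c) x.
have DG u : 'D_u G x = \matrix_(b, c) \sum_a u 0 a * d a b c.
  apply/matrixP => b c; rewrite (derive_row_sum _ dG) summxE mxE.
  by apply: eq_bigr => a _; rewrite mxE (derive_coord _ _ _ dG).
have key m : (christoffel_form D g phi x v v *m G x) 0 m =
    \sum_j v 0 j * (\sum_a v 0 a * d a j m) -
    2^-1 * \sum_j v 0 j * (\sum_i v 0 i * d m i j).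
  rewrite mxE.
  transitivity (\sum_i \sum_j v 0 i * v 0 j *
      \sum_k christoffel D g phi x k i j * G x k m).
    rewrite [RHS](eq_bigr (fun i => \sum_k \sum_j
      christoffel D g phi x k i j * v 0 i * v 0 j * G x k m)); last first.
      move=> i _; rewrite exchange_big /=; apply: eq_bigr => j _.
      rewrite mulr_sumr; apply: eq_bigr => k _; ring.
    rewrite exchange_big /=; apply: eq_bigr => k _.
    rewrite mxE mulr_suml; apply: eq_bigr => i _.
    by rewrite mulr_suml.
  under eq_bigr => i _ do under eq_bigr => j _ do rewrite christoffel_lowered //.
  rewrite -/G.
  pose S1 := \sum_i \sum_j v 0 i * v 0 j * d i j m.
  pose S2 := \sum_i \sum_j v 0 i * v 0 j * d m i j.
  transitivity (S1 - 2^-1 * S2).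
    have S1' : \sum_i \sum_j v 0 i * v 0 j * d j i m = S1.
      rewrite exchange_big; apply: eq_bigr => i _; apply: eq_bigr => j _.
      by rewrite [v 0 j * _]mulrC.
    have -> : S1 - 2^-1 * S2 = 2^-1 * (S1 + S1 - S2) by field.
    rewrite -{2}S1' /S1 /S2 -big_split /= -sumrB mulr_sumr; apply: eq_bigr => i _.
    rewrite -big_split /= -sumrB mulr_sumr; apply: eq_bigr => j _.
    by rewrite /d; ring.
  congr (_ - _ * _).
    rewrite /S1 exchange_big; apply: eq_bigr => j _; rewrite mulr_sumr.
    by apply: eq_bigr => a _; ring.
  rewrite /S2 exchange_big; apply: eq_bigr => j _; rewrite mulr_sumr.
  by apply: eq_bigr => a _; ring.
apply/matrixP => a b; rewrite !ord1 !mxE; move: key => {a b} key.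
rewrite (eq_bigr (fun m => \sum_j v 0 j * (\sum_a v 0 a * d a j m) * w 0 m -
    2^-1 * \sum_j v 0 j * (\sum_i v 0 i * d m i j) * w 0 m)); last first.
  by move=> m _; rewrite key mxE mulrBl mulr_suml -mulrA mulr_suml.
rewrite sumrB; congr (_ - _).
  apply: eq_bigr => m _; rewrite !mxE mulr_suml; apply: eq_bigr => j _.
  by rewrite DG mxE.
rewrite -mulr_sumr; congr (_ * _).
rewrite exchange_big; apply: eq_bigr => j _; rewrite !mxE mulr_suml.
transitivity (\sum_m \sum_i v 0 j * (v 0 i * d m i j) * w 0 m).
  by apply: eq_bigr => m _; rewrite mulr_sumr mulr_suml.
rewrite exchange_big; apply: eq_bigr => i _.
rewrite DG mxE mulr_sumr mulr_suml; apply: eq_bigr => m _; ring.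
Qed.

Definition geodesic_at phi (x : R -> 'rV[R]_n) (t : R) : Prop :=
  'D_1 ('D_1 x) t + christoffel_form D g phi (x t) ('D_1 x t) ('D_1 x t) = 0.

Lemma euler_lagrange_christoffel phi x a v w :
  let G := metric_in_chart D g phi in
  G x \in unitmx -> differentiable G x ->
  euler_lagrange G x a v w = (a + christoffel_form D g phi x v v) *m G x *m w^T.
Proof.
move=> G uG dG; rewrite !mulmxDl christoffel_form_lowered //.
by rewrite /euler_lagrange addrA.
Qed.

(** Lowering the index with the invertible metric, the geodesic equation says
    that the Euler-Lagrange expression vanishes; a condition that does not depend on
    the chart. *)
Lemma geodesic_at_transition phi psi (O : set R) x t :
  atlas D phi -> atlas D psi -> open O -> O t -> smooth_on O x ->
  (forall s, O s -> overlap phi psi (x s)) ->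
  geodesic_at phi x t -> geodesic_at psi (transition phi psi \o x) t.
Proof.
move=> ap aq oO Ot sx ovl geo.
set T := transition phi psi; set J := jac T (x t).
pose G := metric_in_chart D g phi; pose H := metric_in_chart D g psi.
have sT : smooth_on (overlap phi psi) T by exact: (smooth_transition (D := D)).
have dT s : O s -> differentiable T (x s).
  by move=> /ovl; exact: smooth_on_differentiable sT.
have dx s : O s -> differentiable x s by exact: smooth_on_differentiable sx.
have dxx s : O s -> differentiable ('D_1 x) s.
  exact: smooth_on_differentiable (smooth_on_derive (1 : R) sx).
have oo := @open_overlap R n M phi psi.
have CT := (smooth_onP _ _).1 sT 2%N.
have dJ : differentiable (jac T) (x t).
  exact: (Ck_differentiable (jac_Ck oo CT) (ovl t Ot)).
have dJx : differentiable (jac T \o x) t by exact: differentiable_comp (dx t Ot) dJ.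
have y1 s : O s -> 'D_1 (T \o x) s = 'D_1 x s *m (jac T \o x) s.
  move=> Os; rewrite (deriveE _ (differentiable_comp (dx s Os) (dT s Os))).
  rewrite (diff_comp (dx s Os) (dT s Os)) /= -(deriveE _ (dx s Os)).
  by rewrite -(deriveE _ (dT s Os)) (derive_jac _ (dT s Os)).
have y2 : 'D_1 ('D_1 (T \o x)) t =
    'D_1 ('D_1 x) t *m J + 'D_1 x t *m 'D_('D_1 x t) (jac T) (x t).
  apply: (etrans (near_eq_derive (1 : R) (near_eq_on oO Ot y1))).
  have e1 := derive_mulmx (1 : R) (dxx t Ot) dJx.
  apply: (etrans e1).
  apply: (congr1 (fun z => 'D_1 ('D_1 x) t *m J + 'D_1 x t *m z)).
  rewrite (deriveE _ dJx) (diff_comp (dx t Ot) dJ) /= -(deriveE _ (dx t Ot)).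
  by rewrite -(deriveE _ dJ).
have /overlapP [xd _] := ovl t Ot.
have /overlapP [yd _] := transition_in (ovl t Ot).
have uG : G (x t) \in unitmx by exact: metric_in_chart_unit.
have uH : H (T (x t)) \in unitmx by exact: metric_in_chart_unit.
have dG : differentiable G (x t) by exact: metric_in_chart_differentiable.
have dH : differentiable H (T (x t)) by exact: metric_in_chart_differentiable.
have HT : (H (T (x t)))^T = H (T (x t)) by exact: metric_in_chart_tr.
have [uJ _] := mulmx1_unit (jac_transitionK ap aq (ovl t Ot)).
have el0 w : euler_lagrange H (T (x t)) ('D_1 ('D_1 (T \o x)) t)
    ('D_1 (T \o x) t) w = 0.
  have -> : w = w *m invmx J *m J by rewrite mulmxKV.
  rewrite y2 (y1 t Ot).
  rewrite -(euler_lagrange_transition _ _ _ oo (ovl t Ot) CT dH HT (G := G)); last first.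
    by move=> y oy; exact: metric_transition.
  apply: (etrans (euler_lagrange_christoffel _ _ _ uG dG)).
  by apply: (etrans (congr1 (fun z => z *m G (x t) *m _^T) geo)); rewrite !mul0mx.
rewrite /geodesic_at; set A := (X in X = 0).
have A0 : A *m H (T (x t)) = 0.
  apply/rowP => i.
  have := etrans (esym (euler_lagrange_christoffel _ _ (delta_mx 0 i) uH dH)) (el0 _).
  by rewrite trmx_delta -colE => /matrixP/(_ 0 0); rewrite mxE => ->; rewrite !mxE.
by rewrite -(mulmxK uH A) A0 mul0mx.
Qed.

End GeodesicEquation.

(** * Existence of geodesics *)

Lemma derive1_fun (R : realType) (V : normedModType R) (x : R -> V) :
  (x^`())%classic = 'D_1 x.
Proof. by apply/funext => t; rewrite derive1E. Qed.

Lemma derive1n2 (R : realType) (V : normedModType R) (x : R -> V) :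
  (x^`(2))%classic = 'D_1 ('D_1 x).
Proof. by rewrite derive1nS derive1n1 !derive1_fun. Qed.

Lemma open_preimage (T T' : topologicalType) (f : T -> T') (I : set T) (B : set T') :
  open I -> open B -> (forall t, I t -> {for t, continuous f}) ->
  open (I `&` f @^-1` B).
Proof.
move=> oI oB cf; rewrite openE => t [It Bt].
have h1 : nbhs t I by exact: open_nbhs_nbhs.
have h2 : nbhs t (f @^-1` B) by apply: (cf t It); exact: open_nbhs_nbhs.
exact: filterI h1 h2.
Qed.

Lemma Ck_row_mx (R : realType) (V : normedModType R) (U : set V) k n1 n2
    (f : V -> 'rV[R]_n1) (h : V -> 'rV[R]_n2) : open U ->
  Ck U k f -> Ck U k h -> Ck U k (fun x => row_mx (f x) (h x)).
Proof.
move=> oU /(Ck_mxP oU) hf /(Ck_mxP oU) hh; apply/(Ck_mxP oU) => i j.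
case: (split_ordP j) => l ->.
  by apply: (Ck_eq oU) (hf i l) => x _; rewrite row_mxEl.
by apply: (Ck_eq oU) (hh i l) => x _; rewrite row_mxEr.
Qed.

Lemma Ck_id (R : realType) (V : normedModType R) (U : set V) k :
  open U -> Ck U k (id : V -> V).
Proof.
move=> oU; case: k => [|k]; split => // v.
apply: (Ck_eq oU (f := cst v)); last exact: Ck_cst.
by move=> x _; rewrite derive_id.
Qed.

Section GeodesicExistence.
Variables (R : realType) (n : nat) (M : topologicalType) (D : manifold R n M).
Variables (g : M -> 'M[R]_n) (hg : pseudo_riemannian D g).

Lemma Ck_christoffel phi k c i j : atlas D phi ->
  Ck (cmap phi @` cdom phi) k (fun x => christoffel D g phi x c i j).
Proof.
move=> ap; have oU := cimg_open (c := phi).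
have [_ _ /(_ phi ap) /smooth_onP sG] := hg.
apply: (CkM oU); first exact: Ck_cst.
apply: (Ck_sum oU) => l _; apply: (CkM oU).
  have := Ck_invmx oU (fun x xd => metric_in_chart_unit hg ap xd) (sG k).
  by move=> /(Ck_mxP oU); apply.
have dC a b e : Ck (cmap phi @` cdom phi) k
    ('D_(delta_mx 0 a) (fun y => metric_in_chart D g phi y b e)).
  by have /(Ck_mxP oU) h := sG k.+1; exact: (h b e).2.
have mC : Ck (cmap phi @` cdom phi) k
    (fun x => -1 * 'D_(delta_mx 0 l) (fun y => metric_in_chart D g phi y i j) x).
  by apply: (CkM oU) => //; exact: Ck_cst.
apply: (Ck_eq oU) (CkD oU (CkD oU (dC i j l) (dC j i l)) mC) => x _.
by rewrite !fctE mulN1r.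
Qed.

(** The geodesic equation in a chart around p is a first-order equation for the
    pair of position and velocity. Its solution is a geodesic in the other
    charts by [geodesic_at_transition]. *)
Lemma geodesic_exists (p : M) (v : 'rV[R]_n) :
  exists (I : set R) (gamma : R -> M), [/\ I 0, geodesic D g I gamma, gamma 0 = p &
    'D_1 (cmap (chart_at D p) \o gamma) 0 = v].
Proof.
set phi := chart_at D p; have ap : atlas D phi by exact: chart_at_atlas.
have pd : cdom phi p by exact: chart_at_dom.
pose U := cmap phi @` cdom phi; have oU : open U by exact: cimg_open.
pose W : set 'rV[R]_(n + n) := lsubmx @^-1` U.
have oW : open W.
  by apply: open_comp oU => y _; exact: continuous_lsubmx.
pose F (y : 'rV[R]_(n + n)) : 'rV[R]_(n + n) :=
  row_mx (rsubmx y) (- christoffel_form D g phi (lsubmx y) (rsubmx y) (rsubmx y)).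
have cl k : Ck W k (lsubmx : 'rV[R]_(n + n) -> 'rV[R]_n).
  by apply: (Ck_linear oW (l := lsubmx)) (Ck_id k oW); exact: continuous_lsubmx.
have cr k : Ck W k (rsubmx : 'rV[R]_(n + n) -> 'rV[R]_n).
  by apply: (Ck_linear oW (l := rsubmx)) (Ck_id k oW); exact: continuous_rsubmx.
have sF : smooth_on W F.
  apply/smooth_onP => k; apply: (Ck_row_mx oW); first exact: cr.
  apply/(Ck_mxP oW) => a c; rewrite ord1.
  apply: (Ck_eq oW (f := fun y => -1 * \sum_i \sum_j
      christoffel D g phi (lsubmx y) c i j * rsubmx y 0 i * rsubmx y 0 j)).
    by move=> y _; rewrite !mxE mulN1r.
  apply: (CkM oW); first exact: Ck_cst.
  apply: (Ck_sum oW) => i _; apply: (Ck_sum oW) => j _.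
  apply: (CkM oW); last by have /(Ck_mxP oW) h := cr k; exact: h.
  apply: (CkM oW); last by have /(Ck_mxP oW) h := cr k; exact: h.
  by apply: (Ck_comp_scalar oW (U' := U)) (Ck_christoffel k c i j ap) (cl k).
pose y0 := row_mx (cmap phi p) v.
have Wy0 : W y0 by rewrite /W /= row_mxKl; exists p.
have [d [Y [d0 Y0 hY]]] := ode_local oW Wy0 ((smooth_onP _ _).1 sF 1%N).
pose I := [set` `]- d, d[] : set R.
have IE t : I t -> `|t| < d by rewrite /I /= in_itv /= ltr_norml.
have I0 : I 0 by rewrite /I /= in_itv /= oppr_lt0 d0.
have oI : open I by exact: interval_open.
have hY' t : I t -> W (Y t) /\ is_derive t (1 : R) Y (F (Y t)) by move=> /IE; exact: hY.
have sY : smooth_on I Y by exact: ode_smooth oW oI sF hY'.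
have dY t : I t -> differentiable Y t by exact: smooth_on_differentiable sY.
pose x := lsubmx \o Y; pose u := rsubmx \o Y.
have sx : smooth_on I x.
  apply/smooth_onP => k; apply: (Ck_linear oI (l := lsubmx)); last exact/(smooth_onP _ _).1.
  exact: continuous_lsubmx.
have dx t : I t -> 'D_1 x t = u t.
  move=> It; have [_ [_ hd]] := hY' t It.
  have dxt : differentiable x t by exact: smooth_on_differentiable sx It.
  apply/rowP => i; rewrite (derive_coord _ _ _ dxt).
  have -> : (fun s => x s 0 i) = (fun s => Y s 0 (lshift n i)).
    by apply/funext => s; rewrite mxE.
  by rewrite -(derive_coord _ _ _ (dY t It)) hd /F row_mxEl.
have du t : I t -> 'D_1 u t = - christoffel_form D g phi (x t) (u t) (u t).
  move=> It; have [_ [_ hd]] := hY' t It.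
  have dut : differentiable u t.
    by apply: (differentiable_comp (dY t It)); exact: differentiable_rsubmx.
  apply/rowP => i; rewrite (derive_coord _ _ _ dut).
  have -> : (fun s => u s 0 i) = (fun s => Y s 0 (rshift n i)).
    by apply/funext => s; rewrite mxE.
  by rewrite -(derive_coord _ _ _ (dY t It)) hd /F row_mxEr.
have geo t : I t -> geodesic_at D g phi x t.
  move=> It; rewrite /geodesic_at (dx t It).
  rewrite (near_eq_derive (1 : R) (near_eq_on oI It dx)) (du t It).
  by rewrite addNr.
have xU t : I t -> U (x t) by move=> /hY' [].
have cx t : I t -> {for t, continuous (cinv phi \o x)}.
  move=> It; apply: continuous_comp.
    by apply: differentiable_continuous; exact: smooth_on_differentiable sx It.
  exact: cinv_continuous (xU t It).
have ovlE psi t : I t -> cdom psi (cinv phi (x t)) -> overlap phi psi (x t).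
  by move=> It h; apply/overlapP; split => //; exact: xU.
have oO (psi : chart R n M) : open (I `&` (cinv phi \o x) @^-1` cdom psi).
  by apply: open_preimage cx => //; exact: cdom_open.
have sO (psi : chart R n M) : smooth_on (I `&` (cinv phi \o x) @^-1` cdom psi) x.
  by move=> s t [It _]; exact: sx.
exists I, (cinv phi \o x); split => //.
- split => //; first exact: interval_is_interval.
    split => // psi aq; apply/smooth_onP => k.
    have sT := (smooth_onP _ _).1 (smooth_transition (D := D) ap aq) k.
    exact: (Ck_comp (oO psi) (@open_overlap R n M phi psi)
      (fun t tO => ovlE psi t (proj1 tO) (proj2 tO)) sT ((smooth_onP _ _).1 (sO psi) k)).
  move=> psi t aq It h; cbv zeta; rewrite derive1n2 derive1_fun.
  apply: (geodesic_at_transition hg ap aq (oO psi) (x := x)) => //.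
  - by move=> s [Is hs]; exact: ovlE.
  - exact: geo.
- by rewrite /x /= Y0 row_mxKl cmapK.
have -> : v = u 0 by rewrite /u /= Y0 row_mxKr.
rewrite -(dx 0 I0); apply: near_eq_derive; apply: (near_eq_on oI I0) => t It /=.
by have [] := cinvP (xU t It).
Qed.

End GeodesicExistence.

(** * Comparison of two connections *)

Lemma delta_bilin (R : realType) n (A : 'M[R]_n) i j :
  (delta_mx 0 i *m A *m (delta_mx 0 j)^T) = (A i j)%:M :> 'M[R]_1.
Proof.
rewrite trmx_delta -rowE -colE; apply/matrixP => a b.
by rewrite !ord1 !mxE eqxx mulr1n.
Qed.

(** The algebra behind Weyl's theorem on projectively equivalent connections.
    Testing on basis vectors and on their sums and differences gives
    P^k_ij = 0 unless k is i or j, and P^j_jj = 2 P^i_ij for i different from j.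
    The trace is then (n + 1) / 2 times P^j_jj, and it vanishes. *)
Lemma weyl_trace_free (R : realType) n (P : 'I_n -> 'M[R]_n) :
  (forall k, (P k)^T = P k) ->
  (forall v : 'rV[R]_n, exists l, forall k, (v *m P k *m v^T) 0 0 = l * v 0 k) ->
  (forall j, \sum_k P k j k = 0) ->
  forall k, P k = 0.
Proof.
move=> sP qP tP.
have sym k i j : P k i j = P k j i by rewrite -{1}(sP k) mxE.
have Q s i j : exists l, forall k, P k i i + s * (2 * P k i j) + s ^+ 2 * P k j j =
    l * ((k == i)%:R + s * (k == j)%:R).
  have [l hl] := qP (delta_mx 0 i + s *: delta_mx 0 j).
  exists l => k; have := hl k.
  have -> : (delta_mx 0 i + s *: delta_mx 0 j : 'rV[R]_n)^T =
    (delta_mx 0 i)^T + s *: (delta_mx 0 j)^T by rewrite linearD linearZ.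
  rewrite !mulmxDl !mulmxDr -!scalemxAl -!scalemxAr -?scalemxAl !delta_bilin.
  rewrite !mxE /= !mulr1n (sym k j i) => h; rewrite -h; ring.
have diag k i : k != i -> P k i i = 0.
  move=> ki; have [l /(_ k)] := Q 0 i i.
  by rewrite (negbTE ki) mulr0 addr0 mulr0 mul0r addr0 expr0n /= mul0r addr0.
have off k i j : k != i -> k != j -> P k i j = 0.
  move=> ki kj; have [l /(_ k)] := Q 1 i j.
  rewrite (negbTE ki) (negbTE kj) (diag k i ki) (diag k j kj) /= => h; lra.
have rel i j : i != j -> P j j j = 2 * P i i j.
  move=> ij; have ji : j != i by rewrite eq_sym.
  have [l1 h1] := Q 1 i j; have [l2 h2] := Q (-1) i j.
  have := h1 i; have := h1 j; have := h2 i; have := h2 j.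
  rewrite !eqxx (negbTE ij) (negbTE ji) (diag j i ji) (diag i j ij) /=.
  move: (P i i i) (P j j j) (P i i j) (P j i j) => a b c e.
  rewrite !expr2 => e1 e2 e3 e4; lra.
have diag0 j : P j j j = 0.
  have := tP j; rewrite (bigD1 j) //=.
  have -> : \sum_(i | i != j) P i j i = \sum_(i | i != j) 2^-1 * P j j j.
    by apply: eq_bigr => i ij; rewrite sym (rel _ _ ij) mulKf // pnatr_eq0.
  rewrite sumr_const -[X in _ + X]mulr_natl mulrA -{1}[P j j j]mul1r -mulrDl => /eqP.
  rewrite mulf_eq0 => /orP [|/eqP //].
  by rewrite gt_eqF // ltr_wpDr // mulr_ge0 // invr_ge0.
have off2 k j : k != j -> P k k j = 0.
  by move=> kj; have := rel k j kj; rewrite diag0 => h; lra.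
move=> k; apply/matrixP => i j; rewrite mxE.
have [<-|ki] := eqVneq k i; have [<-|kj] := eqVneq k j.
- exact: diag0.
- exact: off2.
- by rewrite sym; exact: off2.
- exact: off.
Qed.

(** The matrix X = E^-1 E' + C is skew-symmetric for G, that is,
    X G + G X^T = 0; such a matrix has trace 0. *)
Lemma trace_of_compatible (R : realType) n (E E' G C : 'M[R]_n) :
  E \in unitmx -> G \in unitmx ->
  E' *m G *m E^T + E *m (C *m G + G *m C^T) *m E^T + E *m G *m E'^T = 0 ->
  \tr C = - \tr (invmx E *m E').
Proof.
move=> uE uG h; pose X := invmx E *m E' + C.
have e1 : E *m (X *m G + G *m X^T) *m E^T = 0.
  have XT : X^T = E'^T *m (invmx E)^T + C^T by rewrite /X [LHS]linearD /= trmx_mul.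
  rewrite -h XT /X !mulmxDl !mulmxDr !mulmxDl !mulmxA.
  rewrite mulmxV // mul1mx -[E *m G *m E'^T *m (invmx E)^T *m E^T]mulmxA.
  rewrite -trmx_mul mulmxV // trmx1 mulmx1 -!addrA; congr (_ + (_ + _)).
  by rewrite addrC.
have e2 : X *m G + G *m X^T = 0.
  have uET : E^T \in unitmx by rewrite unitmx_tr.
  by rewrite -(mulKmx uE (_ + _)) -(mulmxK uET (E *m _)) e1 mul0mx mulmx0.
have e3 : X = - (G *m X^T *m invmx G).
  move/eqP: e2; rewrite addr_eq0 => /eqP e2.
  by rewrite -{1}(mulmxK uG X) e2 mulNmx.
have e4 : \tr X = 0.
  have : \tr X = - \tr X.
    rewrite {1}e3 (raddfN (@mxtrace R n)) /= mxtrace_mulC mulmxA.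
    by rewrite mulVmx // mul1mx mxtrace_tr.
  by move=> ?; lra.
move/eqP: e4; rewrite /X mxtraceD addrC addr_eq0 => /eqP; exact.
Qed.

Section ChristoffelMatrix.
Variables (R : realType) (n : nat) (M : topologicalType) (D : manifold R n M).
Implicit Types (g : M -> 'M[R]_n) (phi : chart R n M).

(** The matrix of the endomorphism w |-> Gamma(v, w), acting on row vectors. *)
Definition christoffel_mx g phi x (v : 'rV[R]_n) : 'M[R]_n :=
  \matrix_(b, k) \sum_a v 0 a * christoffel D g phi x k a b.

Lemma christoffel_mx_delta g phi x a :
  christoffel_mx g phi x (delta_mx 0 a) =
  \matrix_(b, l) christoffel D g phi x l a b.
Proof.
apply/matrixP => b l; rewrite !mxE (bigD1 a) //= mxE !eqxx mul1r big1 ?addr0 //.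
by move=> a' aa'; rewrite mxE (negbTE aa') andbF mul0r.
Qed.

Lemma christoffel_formE g phi x v w :
  christoffel_form D g phi x v w = w *m christoffel_mx g phi x v.
Proof.
apply/rowP => k; rewrite !mxE exchange_big /=; apply: eq_bigr => j _.
by rewrite mxE mulr_sumr; apply: eq_bigr => i _; ring.
Qed.

Lemma metric_compatible g phi x v : pseudo_riemannian D g ->
  let G := metric_in_chart D g phi in let C := christoffel_mx g phi x v in
  G x \in unitmx -> differentiable G x ->
  'D_v G x = C *m G x + G x *m C^T.
Proof.
move=> hg G C uG dG; apply/matrixP => b c.
rewrite (derive_row_sum _ dG) summxE !mxE.
rewrite (eq_bigr (fun a => \sum_k v 0 a * christoffel D g phi x k a b * G x k c +
   \sum_k G x b k * (v 0 a * christoffel D g phi x k a c))); last first.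
  move=> a _; rewrite mxE (derive_coord _ _ _ dG) (christoffel_metric _ _ _ hg uG).
  rewrite mulrDr !mulr_sumr; congr (_ + _); apply: eq_bigr => k _; ring.
rewrite big_split /=; congr (_ + _); rewrite exchange_big; apply: eq_bigr => k _.
  by rewrite [C b k]mxE mulr_suml.
by rewrite [C^T k c]mxE [C c k]mxE mulr_sumr.
Qed.

(** Koszul's argument: the combination of derivatives of the metric that defines
    its Christoffel symbols gives back any symmetric connection for which the
    metric is parallel, because the other terms cancel in pairs. *)
Lemma christoffel_unique g g' phi x :
  pseudo_riemannian D g -> pseudo_riemannian D g' ->
  let G := metric_in_chart D g' phi in
  G x \in unitmx -> differentiable G x ->
  (forall v, 'D_v G x = christoffel_mx g phi x v *m G x +
                        G x *m (christoffel_mx g phi x v)^T) ->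
  forall k i j, christoffel D g' phi x k i j = christoffel D g phi x k i j.
Proof.
move=> hg hg' G uG dG hG k i j.
pose L a b c := \sum_k christoffel D g phi x k a b * G x k c.
have LS a b c : L a b c = L b a c.
  by apply: eq_bigr => l _; rewrite (christoffel_torsion_free phi x l a b hg).
have dE a b c : 'D_(delta_mx 0 a) (fun y => G y b c) x = L a b c + L a c b.
  rewrite -(derive_coord _ _ _ dG) hG christoffel_mx_delta [LHS]mxE.
  congr (_ + _); rewrite [LHS]mxE.
    by apply: eq_bigr => l _; rewrite [X in X * _]mxE.
  apply: eq_bigr => l _; rewrite [X in _ * X]mxE [X in _ * X]mxE mulrC.
  by congr (_ * _); apply: metric_in_chart_sym.
have key m : \sum_l christoffel D g' phi x l i j * G x l m = L i j m.
  rewrite (christoffel_lowered hg' _ _ _ uG) !dE.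
  by rewrite (LS j i m) (LS j m i) (LS m i j); field.
pose r1 := \row_l christoffel D g' phi x l i j.
pose r2 := \row_l christoffel D g phi x l i j.
have r12 : r1 = r2.
  apply: (can_inj (mulmxK uG)); apply/rowP => m.
  rewrite [LHS]mxE [RHS]mxE; transitivity (L i j m); last first.
    by apply: eq_bigr => l _; rewrite [in RHS]mxE.
  by rewrite -key; apply: eq_bigr => l _; rewrite [r1 0 l]mxE.
by have := congr1 (fun r : 'rV_n => r 0 k) r12; rewrite !mxE.
Qed.

Lemma christoffel_formZ g phi x (a : R) v :
  christoffel_form D g phi x (a *: v) (a *: v) =
  a ^+ 2 *: christoffel_form D g phi x v v.
Proof.
apply/rowP => k; rewrite !mxE mulr_sumr; apply: eq_bigr => i _.
by rewrite mulr_sumr; apply: eq_bigr => j _; rewrite !mxE; ring.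
Qed.

End ChristoffelMatrix.

Lemma derive_scale (R : realType) (V : normedModType R) n (f : V -> R)
    (w : V -> 'rV[R]_n) x v : differentiable f x -> differentiable w x ->
  'D_v (fun y => f y *: w y) x = 'D_v f x *: w x + f x *: 'D_v w x.
Proof.
move=> df dw; have dwi i := (differentiable_mxP w x).1 dw 0 i.
have E i : (fun y => (f y *: w y) 0 i) = (fun y => f y * w y 0 i).
  by apply/funext => y; rewrite mxE.
have dfw : differentiable (fun y => f y *: w y) x.
  apply/differentiable_mxP => a i; rewrite ord1 E.
  exact: (@differentiableM _ _ f (fun y => w y 0 i)).
apply/rowP => i; rewrite (derive_coord _ _ _ dfw) E (derive_mul_fun _ df (dwi i)) !mxE.
by rewrite (derive_coord _ _ _ dw).
Qed.

Lemma derive1_comp_curve (R : realType) (V : normedModType R) (f : R -> R)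
    (y : R -> V) t : differentiable f t -> differentiable y (f t) ->
  'D_1 (y \o f) t = 'D_1 f t *: 'D_1 y (f t).
Proof.
move=> df dy; rewrite (deriveE _ (differentiable_comp df dy)) (diff_comp df dy) /=.
rewrite (deriveE _ df) (deriveE _ dy) -linearZ /=; congr ('d y _ _).
by rewrite [_ *: 1]mulr1.
Qed.

Section Equivalence.
Variables (R : realType) (n : nat) (M : topologicalType) (D : manifold R n M).
Variables (g gbar : M -> 'M[R]_n) (hg : pseudo_riemannian D g).

(** If x = y \o tau, then x' = tau' y' and x'' = tau'' y' + tau'^2 y''. Replacing
    both second derivatives by the geodesic equations leaves the term
    tau'' y', a multiple of v = x'. *)
Lemma geodesically_equivalent_christoffel (p : M) (v : 'rV[R]_n) :
  geodesically_equivalent D gbar g ->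
  let phi := chart_at D p in let x0 := cmap phi p in
  exists l, christoffel_form D gbar phi x0 v v -
            christoffel_form D g phi x0 v v = l *: v.
Proof.
move=> eqv phi x0.
have [I [gamma [I0 geo gamma0 xv]]] := geodesic_exists hg p v.
have [tau [c [stau tau0 geoc gc]]] := eqv I gamma geo.
have [oI _ [cgamma _] geo_g] := geo.
have [oI2 _ [cc sc] geo_gb] := geoc.
have ap : atlas D phi by exact: chart_at_atlas.
have pd : cdom phi p by exact: chart_at_dom.
pose x := cmap phi \o gamma; pose y := cmap phi \o c.
pose O := I `&` gamma @^-1` cdom phi.
have oO : open O by apply: open_preimage => //; exact: cdom_open.
have O0 : O 0 by split => //; rewrite /= gamma0.
pose O2 := (tau @` I) `&` c @^-1` cdom phi.
have sy : smooth_on O2 y by exact: sc.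
have OO2 t : O t -> O2 (tau t).
  by move=> [It h]; split; [exists t|rewrite /= -gc].
have dtau t : O t -> differentiable tau t.
  by move=> [It _]; exact: smooth_on_differentiable stau It.
have dtau' t : O t -> differentiable ('D_1 tau) t.
  by move=> [It _]; exact: smooth_on_differentiable (smooth_on_derive (1 : R) stau) It.
have dy t : O t -> differentiable y (tau t).
  by move=> /OO2; exact: smooth_on_differentiable sy.
have dy' t : O t -> differentiable ('D_1 y) (tau t).
  by move=> /OO2; exact: smooth_on_differentiable (smooth_on_derive (1 : R) sy).
have xE t : O t -> x t = (y \o tau) t.
  by move=> [It _]; rewrite /x /y /= gc.
have x1 t : O t -> 'D_1 x t = 'D_1 tau t *: ('D_1 y \o tau) t.
  move=> Ot; rewrite (near_eq_derive (1 : R) (near_eq_on oO Ot xE)).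
  exact: derive1_comp_curve (dtau t Ot) (dy t Ot).
have dyt : differentiable ('D_1 y \o tau) 0.
  exact: differentiable_comp (dtau 0 O0) (dy' 0 O0).
have x2 : 'D_1 ('D_1 x) 0 = 'D_1 ('D_1 tau) 0 *: 'D_1 y (tau 0) +
    'D_1 tau 0 *: ('D_1 tau 0 *: 'D_1 ('D_1 y) (tau 0)).
  apply: (etrans (near_eq_derive (1 : R) (near_eq_on oO O0 x1))).
  apply: (etrans (derive_scale (1 : R) (dtau' 0 O0) dyt)).
  apply: (congr1 (fun z => 'D_1 ('D_1 tau) 0 *: 'D_1 y (tau 0) + 'D_1 tau 0 *: z)).
  exact: derive1_comp_curve (dtau 0 O0) (dy' 0 O0).
have ex : 'D_1 ('D_1 x) 0 = - christoffel_form D g phi x0 v v.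
  have := geo_g phi 0 ap I0 O0.2; cbv zeta; rewrite derive1n2 derive1_fun.
  rewrite -/phi -/x xv /x /= gamma0 => /eqP; rewrite addr_eq0 => /eqP; exact.
have g0c : gamma 0 = c (tau 0) by exact: gc.
have cd0 : cdom phi (c (tau 0)) by rewrite -g0c gamma0.
have yx0 : y (tau 0) = x0 by rewrite /y /= -g0c gamma0.
have ey : 'D_1 ('D_1 y) (tau 0) =
    - christoffel_form D gbar phi x0 ('D_1 y (tau 0)) ('D_1 y (tau 0)).
  have := geo_gb phi (tau 0) ap (OO2 0 O0).1 cd0.
  cbv zeta; rewrite derive1n2 derive1_fun -/y yx0.
  by move=> /eqP; rewrite addr_eq0 => /eqP.
have t0 : 'D_1 tau 0 != 0 by have := tau0 0 I0; rewrite derive1_fun.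
have vE : v = 'D_1 tau 0 *: 'D_1 y (tau 0) by rewrite -xv -/phi -/x (x1 0 O0).
exists ('D_1 ('D_1 tau) 0 / 'D_1 tau 0).
move: x2; rewrite ex ey; move: vE.
move: ('D_1 ('D_1 tau) 0) ('D_1 tau 0) ('D_1 y (tau 0)) t0 => t2 t1 w t10 ->.
move=> h; rewrite [RHS]scalerA divfK // !christoffel_formZ.
move: h; rewrite christoffel_formZ => ->.
rewrite !scalerN !scalerA expr2.
by rewrite addrCA addrN addr0.
Qed.

End Equivalence.

(** * Frames with constant Gram matrices *)

Section Frames.
Variables (R : realType) (n : nat) (M : topologicalType) (D : manifold R n M).
Variable e : 'I_n -> M -> 'rV[R]_n.
Implicit Types (phi : chart R n M) (g : M -> 'M[R]_n).

Definition frame_mx (p : M) : 'M[R]_n := \matrix_i e i p.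

Definition frame_in_chart phi x : 'M[R]_n := \matrix_i vf_in_chart D (e i) phi x.

Lemma vf_in_chartE (X : M -> 'rV[R]_n) phi x : atlas D phi ->
  (cmap phi @` cdom phi) x ->
  let q := cinv phi x in let c := chart_at D q in
  vf_in_chart D X phi x = X q *m jac (transition c phi) (transition phi c x).
Proof.
move=> ap xd q c; have [qd _] := cinvP xd.
have oc : overlap c phi (cmap c q) by apply: overlap_cmap => //; exact: chart_at_dom.
apply: derive_jac.
exact: (differentiable_transition (D := D) (chart_at_atlas D q) ap oc).
Qed.

Lemma frame_in_chartE phi x : atlas D phi -> (cmap phi @` cdom phi) x ->
  let q := cinv phi x in let c := chart_at D q in
  frame_in_chart phi x = frame_mx q *m jac (transition c phi) (transition phi c x).
Proof.
move=> ap xd q c; apply/row_matrixP => i.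
by rewrite row_mul !rowK; exact: vf_in_chartE.
Qed.

Lemma frame_gram g phi x : atlas D phi -> (cmap phi @` cdom phi) x ->
  frame_in_chart phi x *m metric_in_chart D g phi x *m (frame_in_chart phi x)^T =
  gram g e (cinv phi x).
Proof.
move=> ap xd; have [qd ex] := cinvP xd.
rewrite (frame_in_chartE ap xd) (metric_in_chartE D g xd) /=.
set q := cinv phi x in qd ex *; set c := chart_at D q.
have qc : cdom c q by exact: chart_at_dom.
have ac : atlas D c by exact: chart_at_atlas.
set A := jac (transition c phi) _; set B := jac (transition phi c) x.
have AB : A *m B = 1%:M.
  have tE : transition c phi (cmap c q) = x by rewrite /transition /= cmapK.
  by have := jac_transitionK ac ap (overlap_cmap qc qd); rewrite tE.
set F := frame_mx q.
have -> : F *m A *m (B *m g q *m B^T) *m (F *m A)^T =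
    F *m (A *m B) *m g q *m (A *m B)^T *m F^T by rewrite !trmx_mul !mulmxA.
rewrite AB trmx1 !mulmx1; apply/matrixP => i j; rewrite [RHS]mxE /pairing.
have eE k : e k q = row k F by rewrite rowK.
rewrite (eE i) (eE j) -row_mul.
by rewrite !mxE; apply: eq_bigr => k _; rewrite !mxE.
Qed.

Hypothesis se : forall i, smooth_vf D (e i).

Lemma frame_in_chart_differentiable phi x : atlas D phi ->
  (cmap phi @` cdom phi) x -> differentiable (frame_in_chart phi) x.
Proof.
move=> ap xd; apply/differentiable_mxP => i j.
have -> : (fun y => frame_in_chart phi y i j) = (fun y => vf_in_chart D (e i) phi y 0 j).
  by apply/funext => y; rewrite mxE.
have h : differentiable (vf_in_chart D (e i) phi) x.
  exact: smooth_on_differentiable (se i ap) xd.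
by move/differentiable_mxP : h; apply.
Qed.

Lemma frame_in_chart_at p :
  frame_in_chart (chart_at D p) (cmap (chart_at D p) p) = frame_mx p.
Proof.
set phi := chart_at D p; have pd : cdom phi p by exact: chart_at_dom.
have ap : atlas D phi by exact: chart_at_atlas.
have xd : (cmap phi @` cdom phi) (cmap phi p) by exists p.
rewrite frame_in_chartE //= cmapK // -/phi.
have E : transition phi phi (cmap phi p) = cmap phi p by rewrite /transition /= cmapK.
rewrite E -[RHS]mulmx1 -(jac_id (cmap phi p)); congr (_ *m _); apply: jac_near.
by apply: (near_eq_on (cimg_open (c := phi)) xd) => y /cinvP [].
Qed.

(** The left side is the derivative of the constant F G F^T. *)
Lemma frame_derive_gram g S phi x v : pseudo_riemannian D g ->
  (forall p, gram g e p = S) -> atlas D phi -> (cmap phi @` cdom phi) x ->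
  let F := frame_in_chart phi in let G := metric_in_chart D g phi in
  'D_v F x *m G x *m (F x)^T + F x *m 'D_v G x *m (F x)^T +
  F x *m G x *m ('D_v F x)^T = 0.
Proof.
move=> hg hS ap xd F G.
have dF : differentiable F x by exact: frame_in_chart_differentiable.
have dG : differentiable G x by exact: metric_in_chart_differentiable.
have h : 'D_v (fun y => F y *m G y *m (F y)^T) x = 0.
  rewrite -(derive_cst S x v); apply: near_eq_derive.
  apply: (near_eq_on (cimg_open (c := phi)) xd) => y yd.
  by rewrite frame_gram // hS.
rewrite -[RHS]h (derive_mulmx v (differentiable_mulmx dF dG) (differentiable_trmx dF)).
by rewrite (derive_mulmx v dF dG) (derive_trmx v dF) mulmxDl.
Qed.

Hypothesis frame_unit : forall p, frame_mx p \in unitmx.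

(** The right side depends on the frame alone, so all metrics with a constant
    Gram matrix in the same frame have the same trace on the left. *)
Lemma christoffel_trace g S p v : pseudo_riemannian D g ->
  (forall p, gram g e p = S) ->
  let phi := chart_at D p in let x := cmap phi p in
  \tr (christoffel_mx D g phi x v) =
  - \tr (invmx (frame_mx p) *m 'D_v (frame_in_chart phi) x).
Proof.
move=> hg hS phi x.
have ap : atlas D phi by exact: chart_at_atlas.
have xd : (cmap phi @` cdom phi) x by exists p => //; exact: chart_at_dom.
have uG := metric_in_chart_unit hg ap xd.
have dG := metric_in_chart_differentiable hg ap xd.
have h := frame_derive_gram v hg hS ap xd.
apply: (trace_of_compatible (frame_unit p) uG).
rewrite -(metric_compatible _ hg uG dG) -(frame_in_chart_at p).
exact: h.
Qed.

Variables (g : M -> 'M[R]_n) (omega : M -> 'rV[R]_n -> 'M[R]_n).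
Hypothesis homega : connection_forms D g e omega.

Lemma connection_forms_mx p v :
  let phi := chart_at D p in let x := cmap phi p in
  'D_v (frame_in_chart phi) x + frame_mx p *m christoffel_mx D g phi x v =
  (omega p v)^T *m frame_mx p.
Proof.
move=> phi x.
have ap : atlas D phi by exact: chart_at_atlas.
have xd : (cmap phi @` cdom phi) x by exists p => //; exact: chart_at_dom.
have dF := frame_in_chart_differentiable ap xd.
apply/row_matrixP => i; rewrite linearD /= !row_mul rowK.
have -> : row i ('D_v (frame_in_chart phi) x) = 'D_v (vf_in_chart D (e i) phi) x.
  have dv : differentiable (vf_in_chart D (e i) phi) x.
    exact: smooth_on_differentiable (se i ap) xd.
  apply/rowP => j; rewrite mxE (derive_coord _ _ _ dF) (derive_coord _ _ _ dv).
  by congr ('D_v _ x); apply/funext => y; rewrite mxE.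
rewrite -christoffel_formE; have := homega p v i.
rewrite /covariant_derivative -/phi -/x => ->.
rewrite mulmx_sum_row; apply: eq_bigr => j _.
by rewrite rowK !mxE.
Qed.

(** The left side is the expression that defines aff; the right side is, up to
    sign, the covariant derivative of gbar for the connection of g, read in the
    frame. *)
Lemma aff_covariant_derivative (gbar : M -> 'M[R]_n) Sbar p v :
  pseudo_riemannian D gbar -> (forall p, gram gbar e p = Sbar) ->
  let phi := chart_at D p in let x := cmap phi p in
  let H := metric_in_chart D gbar phi in let C := christoffel_mx D g phi x v in
  Sbar *m omega p v + (omega p v)^T *m Sbar =
  frame_mx p *m (C *m H x + H x *m C^T - 'D_v H x) *m (frame_mx p)^T.
Proof.
move=> hgbar hSbar phi x H C.
have ap : atlas D phi by exact: chart_at_atlas.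
have pd : cdom phi p by exact: chart_at_dom.
have xd : (cmap phi @` cdom phi) x by exists p.
have h := frame_derive_gram v hgbar hSbar ap xd.
have hF := connection_forms_mx p v.
have gr : frame_mx p *m H x *m (frame_mx p)^T = Sbar.
  by rewrite -(hSbar p) -[in RHS](cmapK pd) -(frame_gram gbar ap xd) frame_in_chart_at.
cbv zeta in h, hF.
rewrite -/phi -/x frame_in_chart_at -/H in h hF.
move: h hF gr; move: ('D_v (frame_in_chart phi) x) ('D_v H x) => F' H'.
rewrite -/C; move: (frame_mx p) (H x) C (omega p v) => F Hx {}C W h hF gr.
have F'E : F' = W^T *m F - F *m C by rewrite -hF addrK.
have F'ET : F'^T = F^T *m W - C^T *m F^T.
  by rewrite F'E linearB /= !trmx_mul trmxK.
rewrite -gr !mulmxA.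
have e1 : W^T *m F *m Hx *m F^T = F' *m Hx *m F^T + F *m C *m Hx *m F^T.
  by rewrite F'E !mulmxBl subrK.
have e2 : F *m Hx *m F^T *m W = F *m Hx *m F'^T + F *m Hx *m C^T *m F^T.
  by rewrite F'ET mulmxBr !mulmxA subrK.
rewrite e1 e2 !mulmxBr !mulmxDr !mulmxBl !mulmxDl !mulmxA.
move: h; move: (F' *m Hx *m F^T) (F *m H' *m F^T) (F *m Hx *m F'^T)
  (F *m Hx *m C^T *m F^T) (F *m C *m Hx *m F^T) => a b c d f h.
have -> : b = - (a + c) by apply/eqP; rewrite -addr_eq0 addrC -addrA [c + b]addrC addrA h.
by apply/matrixP => i j; rewrite !mxE; ring.
Qed.

End Frames.

(** * Equivalence and parallelism *)

Section FrameEquivalence.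
Variables (R : realType) (n : nat) (M : topologicalType) (D : manifold R n M).
Variables (e : 'I_n -> M -> 'rV[R]_n) (se : forall i, smooth_vf D (e i)).
Hypothesis frame_unit : forall p, frame_mx e p \in unitmx.
Variables (g gbar : M -> 'M[R]_n) (S Sbar : 'M[R]_n).
Hypotheses (hg : pseudo_riemannian D g) (hgbar : pseudo_riemannian D gbar).
Hypotheses (hS : forall p, gram g e p = S) (hSbar : forall p, gram gbar e p = Sbar).
Variables (omega : M -> 'rV[R]_n -> 'M[R]_n) (homega : connection_forms D g e omega).

Lemma equivalent_christoffel_eq p : geodesically_equivalent D gbar g ->
  let phi := chart_at D p in let x := cmap phi p in
  forall k i j, christoffel D gbar phi x k i j = christoffel D g phi x k i j.
Proof.
move=> eqv phi x k i j.
pose P k : 'M[R]_n := \matrix_(i, j)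
  (christoffel D gbar phi x k i j - christoffel D g phi x k i j).
have P0 : forall k, P k = 0.
  apply: weyl_trace_free => [k'|v|j'].
  - apply/matrixP => a b; rewrite !mxE.
    by rewrite (christoffel_torsion_free phi x k' b a hg)
               (christoffel_torsion_free phi x k' b a hgbar).
  - have [l hl] := geodesically_equivalent_christoffel hg p v eqv.
    exists l => k'; have := congr1 (fun u : 'rV[R]_n => u 0 k') hl.
    rewrite [RHS]mxE => <-; rewrite -/phi -/x.
    have fE h : christoffel_form D h phi x v v 0 k' =
      \sum_a \sum_b christoffel D h phi x k' a b * v 0 a * v 0 b by rewrite mxE.
    rewrite [RHS]mxE [X in _ + X]mxE !fE -sumrB [LHS]mxE.
    rewrite (eq_bigr (fun b => \sum_a (christoffel D gbar phi x k' a b * v 0 a * v 0 b -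
      christoffel D g phi x k' a b * v 0 a * v 0 b))); last first.
      by move=> b _; rewrite !mxE mulr_suml; apply: eq_bigr => a _; rewrite !mxE; ring.
    rewrite exchange_big /=; apply: eq_bigr => a _.
    by rewrite sumrB.
  - have t1 := christoffel_trace se frame_unit p (delta_mx 0 j') hg hS.
    have t2 := christoffel_trace se frame_unit p (delta_mx 0 j') hgbar hSbar.
    have := etrans t2 (esym t1); rewrite !christoffel_mx_delta => /eqP.
    rewrite -subr_eq0 /mxtrace -sumrB => /eqP tr0; rewrite -[RHS]tr0.
    by apply: eq_bigr => k' _; rewrite !mxE.
have := congr1 (fun A : 'M[R]_n => A i j) (P0 k).
by rewrite !mxE => /eqP; rewrite subr_eq0 => /eqP.
Qed.

Lemma equivalent_aff p v : geodesically_equivalent D gbar g ->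
  Sbar *m omega p v + (omega p v)^T *m Sbar = 0.
Proof.
move=> eqv.
rewrite (aff_covariant_derivative se homega p v hgbar hSbar).
set phi := chart_at D p; set x := cmap phi p.
have ap : atlas D phi by exact: chart_at_atlas.
have xd : (cmap phi @` cdom phi) x by exists p => //; exact: chart_at_dom.
have uG := metric_in_chart_unit hgbar ap xd.
have dG := metric_in_chart_differentiable hgbar ap xd.
rewrite (metric_compatible v hgbar uG dG).
have -> : christoffel_mx D gbar phi x v = christoffel_mx D g phi x v.
  apply/matrixP => b k; rewrite !mxE; apply: eq_bigr => a _.
  by rewrite equivalent_christoffel_eq.
by rewrite subrr mulmx0 mul0mx.
Qed.

(** The covariant derivative K v of gbar is linear in v and vanishes on the
    frame, hence everywhere. *)
Lemma aff_christoffel_eq p :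
  (forall i, Sbar *m omega p (e i p) + (omega p (e i p))^T *m Sbar = 0) ->
  let phi := chart_at D p in let x := cmap phi p in
  forall k i j, christoffel D gbar phi x k i j = christoffel D g phi x k i j.
Proof.
move=> h phi x; pose H := metric_in_chart D gbar phi.
have ap : atlas D phi by exact: chart_at_atlas.
have xd : (cmap phi @` cdom phi) x by exists p => //; exact: chart_at_dom.
have uG : H x \in unitmx by exact: metric_in_chart_unit.
have dG : differentiable H x by exact: metric_in_chart_differentiable.
pose K v := christoffel_mx D g phi x v *m H x +
            H x *m (christoffel_mx D g phi x v)^T - 'D_v H x.
have CL v : christoffel_mx D g phi x v =
    \sum_a v 0 a *: christoffel_mx D g phi x (delta_mx 0 a).
  apply/matrixP => b k; rewrite summxE mxE; apply: eq_bigr => a _.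
  by rewrite christoffel_mx_delta !mxE.
have KL v : K v = \sum_a v 0 a *: K (delta_mx 0 a).
  rewrite /K (derive_row_sum v dG) (CL v) linear_sum /= mulmx_suml mulmx_sumr.
  rewrite -big_split /= -sumrB; apply: eq_bigr => a _.
  by rewrite linearZ /= -scalemxAl -scalemxAr -scalerDr -scalerBr.
have Ke i : K (e i p) = 0.
  have := aff_covariant_derivative se homega p (e i p) hgbar hSbar.
  rewrite h => /esym E.
  have uF := frame_unit p; have uFT : (frame_mx e p)^T \in unitmx by rewrite unitmx_tr.
  apply: (can_inj (mulKmx uF)); apply: (can_inj (mulmxK uFT)).
  by rewrite mulmx0 mul0mx; exact: E.
have Ka a : K (delta_mx 0 a) = 0.
  apply/matrixP => b c; rewrite [RHS]mxE.
  pose kap : 'cV[R]_n := \col_a K (delta_mx 0 a) b c.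
  have k0 : frame_mx e p *m kap = 0.
    apply/colP => i; rewrite [LHS]mxE [RHS]mxE.
    have := congr1 (fun A : 'M[R]_n => A b c) (Ke i).
    rewrite KL summxE [RHS]mxE => E; rewrite -[RHS]E.
    by apply: eq_bigr => a' _; rewrite [RHS]mxE [kap _ _]mxE [frame_mx _ _ _ _]mxE.
  have : kap a 0 = 0 by rewrite -(mulKmx (frame_unit p) kap) k0 mulmx0 mxE.
  by rewrite mxE.
apply: (christoffel_unique hg hgbar uG dG) => v.
apply/esym/eqP; rewrite -subr_eq0; apply/eqP; rewrite -/(K v) KL.
by rewrite big1 // => a _; rewrite Ka scaler0.
Qed.

(** The symbols of the two metrics are compared at each point only in the chart
    attached to that point, so the equation is transported from there to an
    arbitrary chart. *)
Lemma aff_equivalent :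
  (forall p i, Sbar *m omega p (e i p) + (omega p (e i p))^T *m Sbar = 0) ->
  geodesically_equivalent D gbar g.
Proof.
move=> h I gamma geo; have [oI itvI sg geo_g] := geo.
exists id, gamma; split => //.
- by apply/smooth_onP => k; exact: Ck_id.
- by move=> t It; rewrite derive1_id oner_neq0.
rewrite image_id; split; [exact: oI|exact: itvI|exact: sg|].
move=> psi t aq It td; cbv zeta; rewrite derive1n2 derive1_fun.
have [cg sc] := sg.
pose p := gamma t; pose phi := chart_at D p.
have ap : atlas D phi by exact: chart_at_atlas.
pose x := cmap phi \o gamma.
have pd : cdom phi p by exact: chart_at_dom.
have geo_x : geodesic_at D g phi x t.
  by have := geo_g phi t ap It pd; cbv zeta; rewrite derive1n2 derive1_fun.
have geo_bar : geodesic_at D gbar phi x t.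
  rewrite /geodesic_at; have -> u : christoffel_form D gbar phi (x t) u u =
      christoffel_form D g phi (x t) u u; last exact: geo_x.
  apply/rowP => k; rewrite [LHS]mxE [RHS]mxE.
  apply: eq_bigr => i _; apply: eq_bigr => j _.
  by rewrite /x /= -/p (aff_christoffel_eq (h p)).
pose O := (I `&` gamma @^-1` cdom phi) `&` gamma @^-1` cdom psi.
have oO : open O.
  apply: open_preimage; [|exact: cdom_open|by move=> s [Is _]; exact: cg].
  by apply: open_preimage => //; exact: cdom_open.
have Ot : O t by [].
have sx : smooth_on O x.
  by move=> s u [Os _]; exact: (sc phi ap).
have ov s : O s -> overlap phi psi (x s).
  by move=> [[_ sd] sd']; exact: overlap_cmap.
have g2 := geodesic_at_transition hgbar ap aq oO Ot sx ov geo_bar.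
have E s : O s -> (transition phi psi \o x) s = (cmap psi \o gamma) s.
  by move=> [[_ sd] _]; rewrite /transition /x /= cmapK.
have E1 s : O s -> 'D_1 (transition phi psi \o x) s = 'D_1 (cmap psi \o gamma) s.
  by move=> Os; apply: near_eq_derive; exact: near_eq_on oO Os E.
have E2 : 'D_1 ('D_1 (transition phi psi \o x)) t = 'D_1 ('D_1 (cmap psi \o gamma)) t.
  by apply: near_eq_derive; exact: near_eq_on oO Ot E1.
by move: g2; rewrite /geodesic_at E2 (E1 t Ot) (E t Ot).
Qed.

End FrameEquivalence.

(** * Left invariant frames *)

Section LieGroupFrames.
Variables (R : realType) (n : nat) (G : lieGroup R n).

(** The product of G with its first factor frozen at a. *)
Lemma differentiable_left_translation (a p : G) :
  differentiable (cmap (chart_at G (a * p)%g) \o (fun q : G => (a * q)%g) \o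
                  cinv (chart_at G p)) (cmap (chart_at G p) p).
Proof.
set chi := chart_at G (a * p)%g; set psi := chart_at G p; set phi := chart_at G a.
have ad : cdom phi a by exact: chart_at_dom.
have pd : cdom psi p by exact: chart_at_dom.
pose f (xy : 'rV[R]_n * 'rV[R]_n) := cmap chi (cinv phi xy.1 * cinv psi xy.2)%g.
have df : differentiable f (cmap phi a, cmap psi p).
  apply: (smooth_on_differentiable (lie_mul_smooth (chart_at_atlas G a)
    (chart_at_atlas G p) (chart_at_atlas G (a * p)%g))).
  split=> /=; [by exists a|by exists p|].
  by rewrite !cmapK //; exact: chart_at_dom.
pose l (y : 'rV[R]_n) := (cmap phi a, y).
have dl : differentiable l (cmap psi p).
  have d1 : differentiable (cst (cmap phi a) : 'rV[R]_n -> 'rV[R]_n) (cmap psi p).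
    exact: differentiable_cst.
  have d2 : differentiable (id : 'rV[R]_n -> 'rV[R]_n) (cmap psi p) by [].
  exact: (differentiable_pair d1 d2).
have -> : cmap chi \o (fun q : G => (a * q)%g) \o cinv psi = f \o l.
  by apply/funext => y; rewrite /f /l /= cmapK.
exact: differentiable_comp.
Qed.

Lemma left_translation_sum (a p : G) (c : 'rV[R]_n) (u : 'I_n -> 'rV[R]_n) :
  left_translation_diff a p (\sum_i c 0 i *: u i) =
  \sum_i c 0 i *: left_translation_diff a p (u i).
Proof.
have df := differentiable_left_translation a p.
rewrite /left_translation_diff /tangent_map /chart_diff (deriveE _ df) linear_sum.
by apply: eq_bigr => i _; rewrite linearZ (deriveE _ df).
Qed.

Lemma left_invariant_vf0 : left_invariant_vf (fun _ : G => 0 : 'rV[R]_n).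
Proof.
split=> [phi ap|a p]; last first.
  by rewrite /left_translation_diff /tangent_map /chart_diff derive0.
have -> : vf_in_chart G (fun _ : G => 0 : 'rV[R]_n) phi = cst 0.
  by apply/funext => x; rewrite /vf_in_chart /chart_diff derive0.
by apply/smooth_onP => k; apply: Ck_cst; exact: cimg_open.
Qed.

(** Left translations carry a linear relation between the e_i at one point to
    every point; it then contradicts their independence as fields. *)
Lemma lie_algebra_basis_unit (e : 'I_n -> G -> 'rV[R]_n) p :
  lie_algebra_basis e -> frame_mx e p \in unitmx.
Proof.
move=> [he ue]; rewrite -row_free_unit; apply: inj_row_free => c hc.
have rel0 : \sum_i c 0 i *: e i p = 0.
  by rewrite -[RHS]hc mulmx_sum_row; apply: eq_bigr => i _; rewrite rowK.
have relq q : \sum_i c 0 i *: e i q = 0.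
  have -> : q = ((q * p^-1) * p)%g by rewrite -mulgA mulVg mulg1.
  rewrite (eq_bigr (fun i => c 0 i *: left_translation_diff (q * p^-1)%g p (e i p))).
    rewrite -left_translation_sum rel0.
    by rewrite /left_translation_diff /tangent_map /chart_diff derive0.
  by move=> i _; rewrite (he i).2.
have [c' [_ uc']] := ue _ left_invariant_vf0.
rewrite -(uc' c (fun q => esym (relq q))); apply: uc' => q.
by rewrite big1 // => i _; rewrite mxE scale0r.
Qed.

End LieGroupFrames.

Theorem proposition3p1 (R : realType) (n : nat) (hn : (2 <= n)%N)
    (G : lieGroup R n)
    (e : 'I_n -> G -> 'rV[R]_n) (he : lie_algebra_basis e)
    (g : G -> 'M[R]_n) (hg : left_invariant_metric g)
    (S : 'M[R]_n) (hS : forall p : G, gram g e p = S)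
    (omega : G -> 'rV[R]_n -> 'M[R]_n) (homega : connection_forms G g e omega)
    (gbar : G -> 'M[R]_n) (hgbar : left_invariant_metric gbar)
    (Sbar : 'M[R]_n) (hSbar : forall p : G, gram gbar e p = Sbar) :
  geodesically_equivalent G gbar g <-> aff omega Sbar.
Proof.
have se i : smooth_vf G (e i) by case: (he.1 i).
have uF p : frame_mx e p \in unitmx by exact: lie_algebra_basis_unit.
split=> [eqv|[_ haff]].
  split=> [|X _ p]; last exact: (equivalent_aff se uF hg.1 hgbar.1 hS hSbar homega).
  have [sb _ _] := hgbar.1; have tr1 (m : 'M[R]_1) : m 0 0 = m^T 0 0 by rewrite mxE.
  rewrite -(hSbar 1%g); apply/matrixP => i j; rewrite !mxE /pairing tr1.
  by rewrite !trmx_mul trmxK sb mulmxA.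
apply: (aff_equivalent se uF hg.1 hgbar.1 hSbar homega) => p i.
exact: haff (he.1 i) p.
Qed.
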